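(* There exist a finitely generated group $\Delta$ and a symmetric finitely supported probability measure $\mu'$ on $\Delta$ (with support generating $\Delta$) such that, for the random walk $Y_n$ with step law $\mu'$ started at the identity and $\|\cdot\|$ a word norm on $\Delta$ with respect to a finite generating set, $$\liminf_n\frac{\log|\log P(Y_n=1)|}{\log n}=\frac13,\quad \limsup_n\frac{\log|\log P(Y_n=1)|}{\log n}=1,$$ $$\liminf_n\frac{\log \mathbb{E}\|Y_n\|}{\log n}=\frac12,\quad \limsup_n\frac{\log \mathbb{E}\|Y_n\|}{\log n}=1.$$
   Context: $Y_n$ denotes the random walk on $\Delta$ whose increments are i.i.d. with law $\mu'$, started at the identity, so $Y_n$ has law $\mu'^{*n}$. *)

(* Defs.v *)
From Stdlib Require Import Reals List.
Open Scope R_scope.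

Record Grp := {
  carrier :> Type;
  gmul : carrier -> carrier -> carrier;
  ginv : carrier -> carrier;
  gone : carrier;
  gmul_assoc : forall x y z, gmul x (gmul y z) = gmul (gmul x y) z;
  gmul_1l : forall x, gmul gone x = x;
  gmul_Vl : forall x, gmul (ginv x) x = gone;
  geq_dec : forall x y : carrier, {x = y} + {x <> y}
}.

Section Defs.
Variable G : Grp.

Definition gprod (w : list G) : G := fold_right (gmul G) (gone G) w.

Definition sym_fin_prob (mu : G -> R) (supp : list G) : Prop :=
  NoDup supp /\
  (forall g, In g supp -> 0 < mu g) /\
  (forall g, ~ In g supp -> mu g = 0) /\
  fold_right Rplus 0 (map mu supp) = 1 /\
  (forall g, mu (ginv G g) = mu g) /\
  (forall g, exists w, Forall (fun s => In s supp) w /\ gprod w = g).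

(* walk_sum mu supp n f x = E[ f (x X_1 ... X_n) ] for i.i.d. X_i ~ mu *)
Fixpoint walk_sum (mu : G -> R) (supp : list G) (n : nat) (f : G -> R) (x : G)
  : R :=
  match n with
  | O => f x
  | S m => fold_right Rplus 0
             (map (fun s => mu s * walk_sum mu supp m f (gmul G x s)) supp)
  end.

Definition return_prob (mu : G -> R) (supp : list G) (n : nat) : R :=
  walk_sum mu supp n (fun g => if geq_dec G g (gone G) then 1 else 0) (gone G).

Definition expected_norm (mu : G -> R) (supp : list G) (nrm : G -> nat)
  (n : nat) : R :=
  walk_sum mu supp n (fun g => INR (nrm g)) (gone G).

Definition letter_of (T : list G) (s : G) : Prop := In s T \/ In (ginv G s) T.

Definition is_word_norm (T : list G) (nrm : G -> nat) : Prop :=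
  forall g,
    (exists w, Forall (letter_of T) w /\ gprod w = g /\ length w = nrm g) /\
    (forall w, Forall (letter_of T) w -> gprod w = g -> (nrm g <= length w)%nat).

End Defs.

Definition liminf_on (D : nat -> Prop) (u : nat -> R) (l : R) : Prop :=
  (forall eps, 0 < eps -> exists N, forall n, (N <= n)%nat -> D n -> l - eps < u n) /\
  (forall eps, 0 < eps -> forall N, exists n, (N <= n)%nat /\ D n /\ u n < l + eps).

Definition limsup_on (D : nat -> Prop) (u : nat -> R) (l : R) : Prop :=
  (forall eps, 0 < eps -> exists N, forall n, (N <= n)%nat -> D n -> u n < l + eps) /\
  (forall eps, 0 < eps -> forall N, exists n, (N <= n)%nat /\ D n /\ l - eps < u n).

(* Main.v *)
Require Import Defs.
From Stdlib Require Import Reals List Lra Lia ZArith Bool FinFun.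
From Stdlib Require Import ClassicalEpsilon FunctionalExtensionality ProofIrrelevance.
Import ListNotations.
Open Scope R_scope.

(** Let [t] and [a] generate the lamplighter group [Z/2 wr Z], acting on [bool * Z].
    For [R], [D] let them also act on a finite graph: a binary tree of depth [D] whose
    nodes are blown up to [t]-cycles of length [3 R], three crossing points of each cycle
    being exchanged by [a] with crossing points of the neighbouring cycles.  Since the
    crossing points are [R] apart, short relations of the lamplighter group hold on this
    graph.  [Delta] is the group generated by the diagonal action on [bool * Z] and on a
    sequence of such graphs, where [R_m] and then [D_m] grow fast enough, and the steps
    are the switch-walk-switch elements [a^e t^(+-1) a^e'].

    The lamplighter quotient forces [P(Y_n = 1) <= exp (- c n^(1/3))] and the quotient [Z]
    forces [E |Y_n| >= c sqrt n] for every [n].  At times that are short compared with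
    [R_m], only finitely many finite permutation groups are visible besides the
    lamplighter group, and those cost only constants, so both bounds are attained up to
    [n^o(1)].  At times that are huge compared with [R_m] but short compared with [D_m]
    the [m]-th graph looks like an infinite tree of cycles: it carries a positive function
    contracted by a factor [1 - c / R_m^2] at each step of the walk, and decaying at most
    exponentially in the word length.  This makes the return probability exponentially
    small and the displacement linear at that time scale. *)

Arguments Nat.eq_dec : simpl never.
Arguments Z.eq_dec : simpl never.
Arguments lt_dec : simpl never.
Arguments Z_le_dec : simpl never.

(** * Words in [t] and [a], and their actions on lamps and on finite graphs *)

Inductive letter := Lt | LT | La.
Notation word := (list letter).

Definition linv (l : letter) : letter :=
  match l with Lt => LT | LT => Lt | La => La end.
Definition winv (w : word) : word := rev (map linv w).

Definition disp (l : letter) : Z :=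
  match l with Lt => 1 | LT => -1 | La => 0 end%Z.

(** A point [(b, i)] is the state [b] of one lamp together with the position [i] of the cursor
    relative to it: moves shift [i], and the switch acts only at [i = 0]. The lamp at site [z] is
    followed by starting at [i = -z]. *)
Definition actL (l : letter) (x : bool * Z) : bool * Z :=
  let (b, i) := x in
  match l with
  | La => if Z.eq_dec i 0 then (negb b, i) else (b, i)
  | _ => (b, (i + disp l)%Z)
  end.

Inductive seg := c0 | c1 | c2.
Definition snext (c : seg) := match c with c0 => c1 | c1 => c2 | c2 => c0 end.
Definition sprev (c : seg) := match c with c0 => c2 | c1 => c0 | c2 => c1 end.

(* [(v, c, k)] is the point at distance [k] after the crossing point [c] on the cycle of the
   tree node [v]; [a] exchanges the crossing point [c0] of the cycle of [b :: v] with [c1] or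
   [c2] of the cycle of [v].  Parameters [pr] stand for [(R, D)]. *)
Notation vertex := (list bool * seg * nat)%type.

Definition valid (pr : nat * nat) (x : vertex) : Prop :=
  (length (fst (fst x)) <= snd pr /\ snd x < fst pr)%nat.

Definition valid_dec pr x : {valid pr x} + {~ valid pr x}.
Proof.
  unfold valid.
  destruct (le_dec (length (fst (fst x))) (snd pr));
  destruct (lt_dec (snd x) (fst pr)); intuition.
Defined.

(** The crossing point [c0] of the root and the points [c1], [c2] of nodes at depth [D] have no
    partner and are fixed, so that the graph is finite and [a] remains an involution. *)
Definition cross (D : nat) (v : list bool) (c : seg) : list bool * seg :=
  match c, v with
  | c0, [] => ([], c0)
  | c0, b :: v' => (v', if b then c1 else c2)
  | c1, _ => if lt_dec (length v) D then (true :: v, c0) else (v, c1)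
  | c2, _ => if lt_dec (length v) D then (false :: v, c0) else (v, c2)
  end.

(** Points outside the graph are fixed, so every letter permutes the whole type [vertex]. *)
Definition actX (pr : nat * nat) (l : letter) (x : vertex) : vertex :=
  if valid_dec pr x then
    let '(v, c, k) := x in
    match l with
    | Lt => if Nat.eq_dec (S k) (fst pr) then (v, snext c, 0%nat) else (v, c, S k)
    | LT => match k with
            | O => (v, sprev c, Nat.pred (fst pr))
            | S k' => (v, c, k')
            end
    | La => match k with
            | O => (cross (snd pr) v c, 0%nat)
            | S _ => x
            end
    end
  else x.

Notation runL := (fold_left (fun x l => actL l x)).
Notation runX pr := (fold_left (fun x l => actX pr l x)).

Lemma actLK l x : actL (linv l) (actL l x) = x.
Proof.
  destruct x as [b i]; destruct l; simpl; try (f_equal; lia).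
  destruct (Z.eq_dec i 0); simpl; destruct (Z.eq_dec i 0); try tauto.
  now rewrite negb_involutive.
Qed.

Lemma cross_valid D v c : (length v <= D)%nat -> (length (fst (cross D v c)) <= D)%nat.
Proof. destruct c, v; simpl; repeat destruct lt_dec; simpl; lia. Qed.

Lemma crossK D v c : (length v <= D)%nat ->
  cross D (fst (cross D v c)) (snd (cross D v c)) = (v, c).
Proof.
  destruct c, v as [|[] v]; simpl; intros H; repeat (destruct lt_dec; simpl in *);
  try reflexivity; exfalso; lia.
Qed.

Lemma actX_valid pr l x : valid pr x -> valid pr (actX pr l x).
Proof.
  intros H. unfold actX. destruct (valid_dec pr x) as [_|]; [|tauto].
  destruct x as [[v c] k]. unfold valid in *; simpl in *.
  destruct l; simpl.
  - destruct (Nat.eq_dec (S k) (fst pr)); simpl; lia.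
  - destruct k; simpl; lia.
  - destruct k; simpl; [|lia]. split; [apply cross_valid|]; lia.
Qed.

Lemma actXK pr l x : actX pr (linv l) (actX pr l x) = x.
Proof.
  destruct (valid_dec pr x) as [H|H].
  - pose proof (actX_valid pr l x H) as H'.
    unfold actX in *. destruct (valid_dec pr x) as [_|]; [|tauto].
    destruct x as [[v c] k]. destruct H as [H1 H2]; simpl in H1, H2.
    destruct l; simpl in *.
    + destruct (Nat.eq_dec (S k) (fst pr)) as [e|e].
      * destruct valid_dec; [|tauto]. rewrite <- e. destruct c; reflexivity.
      * destruct valid_dec; [|tauto]. reflexivity.
    + destruct k.
      * destruct valid_dec; [|tauto].
        destruct Nat.eq_dec; [|lia]. destruct c; reflexivity.
      * destruct valid_dec; [|tauto]. destruct Nat.eq_dec; [lia|reflexivity].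
    + destruct k.
      * destruct valid_dec; [|tauto].
        pose proof (crossK (snd pr) v c H1). destruct (cross (snd pr) v c); simpl in *.
        now rewrite H.
      * destruct valid_dec; [reflexivity|tauto].
  - unfold actX. destruct (valid_dec pr x); [tauto|].
    destruct (valid_dec pr x); tauto.
Qed.

(** * Inverse words, displacement and elementary facts on both actions *)

Section Run.
Context {T : Type} (act : letter -> T -> T).
Hypothesis actK : forall l x, act (linv l) (act l x) = x.
Notation run := (fold_left (fun x l => act l x)).

Lemma run_winvK w x : run (winv w) (run w x) = x.
Proof.
  unfold winv. revert x. induction w as [|l w IH]; intros x; simpl; auto.
  rewrite fold_left_app, IH. simpl. apply actK.
Qed.

Lemma winvK w : winv (winv w) = w.
Proof.
  unfold winv. rewrite map_rev, rev_involutive, map_map.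
  rewrite <- (map_id w) at 2. apply map_ext. now intros [].
Qed.

Lemma run_Kwinv w x : run w (run (winv w) x) = x.
Proof. rewrite <- (winvK w) at 1. apply run_winvK. Qed.

End Run.

Lemma winv_app u w : winv (u ++ w) = winv w ++ winv u.
Proof. unfold winv. now rewrite map_app, rev_app_distr. Qed.

Lemma winv_length w : length (winv w) = length w.
Proof. unfold winv. now rewrite length_rev, length_map. Qed.

Lemma runX_valid pr w x : valid pr x -> valid pr (runX pr w x).
Proof.
  revert x; induction w as [|l w IH]; intros x H; simpl; auto.
  apply IH, actX_valid, H.
Qed.

Lemma runX_invalid pr w x : ~ valid pr x -> runX pr w x = x.
Proof.
  intros H. induction w as [|l w IH]; simpl; auto.
  unfold actX at 2. destruct (valid_dec pr x); [tauto|auto].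
Qed.

Fixpoint pos (w : word) : Z :=
  match w with [] => 0 | l :: w' => disp l + pos w' end%Z.

Lemma pos_app u w : pos (u ++ w) = (pos u + pos w)%Z.
Proof. induction u as [|l u IH]; simpl; lia. Qed.

Lemma pos_length w : (Z.abs (pos w) <= Z.of_nat (length w))%Z.
Proof. induction w as [|l w IH]; [simpl; lia|]. cbn [pos length].
  destruct l; cbn [disp]; lia. Qed.

Lemma runL_pos w b i : snd (runL w (b, i)) = (i + pos w)%Z.
Proof.
  revert b i; induction w as [|l w IH]; intros b i; [simpl; lia|].
  change (snd (runL w (actL l (b, i))) = (i + (disp l + pos w))%Z).
  destruct l; simpl actL; simpl disp; try (rewrite IH; lia).
  destruct (Z.eq_dec i 0); rewrite IH; lia.
Qed.

(** Switching the bit commutes with the action, so a word is known on all points from its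
    displacement and its effect on points with bit [false]. *)
Lemma runL_flip w b i :
  runL w (b, i) = (xorb b (fst (runL w (false, i))), (i + pos w)%Z).
Proof.
  apply injective_projections; [|now rewrite runL_pos].
  simpl. revert b i; induction w as [|l w IH]; intros b i; [now destruct b|].
  destruct l; simpl; [apply IH|apply IH|].
  destruct (Z.eq_dec i 0); [|apply IH].
  rewrite (IH (negb b)), (IH true). now destruct b, (fst (runL w (false, i))).
Qed.

(* The map [(b, z) |-> (a^b y) t^z] carries the action on [bool * Z] to the action on
   the finite graph as long as [|z| < R], since [a] moves no vertex strictly between
   two crossing points. *)
Definition local_chart (pr : nat * nat) (v : list bool) (c : seg) (x : bool * Z) : vertex :=
  let (b, z) := x in
  let (v', c') := if b then cross (snd pr) v c else (v, c) in
  if Z_le_dec 0 z then (v', c', Z.to_nat z)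
  else (v', sprev c', Z.to_nat (Z.of_nat (fst pr) + z)).

Lemma local_chart_act pr v c l b z :
  (length v <= snd pr)%nat -> (Z.abs z + 1 < Z.of_nat (fst pr))%Z ->
  local_chart pr v c (actL l (b, z)) = actX pr l (local_chart pr v c (b, z)).
Proof.
  intros Hv Hz.
  assert (V : valid pr (local_chart pr v c (b, z))).
  { pose proof (cross_valid (snd pr) v c Hv).
    unfold local_chart, valid. destruct b.
    - destruct (cross (snd pr) v c); destruct Z_le_dec; simpl in *; lia.
    - destruct Z_le_dec; simpl in *; lia. }
  unfold actX. destruct valid_dec as [_|]; [|tauto]. clear V.
  destruct l.
  - simpl actL. unfold local_chart.
    destruct (if b then cross (snd pr) v c else (v, c)) as [v' c'].
    destruct (Z_le_dec 0 z), (Z_le_dec 0 (z + 1)); try lia;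
    destruct Nat.eq_dec; try lia; try (f_equal; lia).
    destruct c'; f_equal; lia.
  - simpl actL. unfold local_chart.
    destruct (if b then cross (snd pr) v c else (v, c)) as [v' c'].
    destruct (Z_le_dec 0 z), (Z_le_dec 0 (z + -1)); try lia.
    + destruct (Z.to_nat z) eqn:E; [lia|]. f_equal; lia.
    + destruct (Z.to_nat z) eqn:E; [|lia]. f_equal; lia.
    + destruct (Z.to_nat (Z.of_nat (fst pr) + z)) eqn:E; [lia|]. f_equal; lia.
  - simpl actL. destruct (Z.eq_dec z 0) as [->|Hz0].
    + pose proof (crossK (snd pr) v c Hv) as K.
      unfold local_chart. destruct b; simpl.
      * destruct (cross (snd pr) v c) as [v' c'] eqn:E; simpl in *. now rewrite K.
      * destruct (cross (snd pr) v c) as [v' c'] eqn:E; simpl in *. reflexivity.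
    + unfold local_chart.
      destruct (if b then cross (snd pr) v c else (v, c)) as [v' c'].
      destruct (Z_le_dec 0 z).
      * destruct (Z.to_nat z) eqn:E; [lia|]. reflexivity.
      * destruct (Z.to_nat (Z.of_nat (fst pr) + z)) eqn:E; [lia|]. reflexivity.
Qed.

Lemma local_chart_run pr v c w b z :
  (length v <= snd pr)%nat -> (Z.abs z + Z.of_nat (length w) < Z.of_nat (fst pr))%Z ->
  local_chart pr v c (runL w (b, z)) = runX pr w (local_chart pr v c (b, z)).
Proof.
  intros Hv. revert b z. induction w as [|l w IH]; intros b z H; [reflexivity|].
  simpl length in H.
  change (local_chart pr v c (runL w (actL l (b, z))) =
          runX pr w (actX pr l (local_chart pr v c (b, z)))).
  rewrite <- local_chart_act by (auto; lia).
  destruct (actL l (b, z)) as [b' z'] eqn:E. apply IH.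
  assert (Z.abs z' <= Z.abs z + 1)%Z; [|lia].
  destruct l; simpl in E; [| |destruct (Z.eq_dec z 0)]; injection E as <- <-; lia.
Qed.

(** Each point lies between two crossing points at distance [R] of each other, and the nearer one is
    the centre of the chart. *)
Lemma local_chart_onto pr x : valid pr x ->
  exists v c z, (length v <= snd pr)%nat /\ (2 * Z.abs z <= Z.of_nat (fst pr))%Z /\
    x = local_chart pr v c (false, z).
Proof.
  destruct x as [[v c] k]. intros [H1 H2]; simpl in H1, H2.
  destruct (le_dec (2 * k) (fst pr)).
  - exists v, c, (Z.of_nat k). repeat split; [auto|lia|].
    unfold local_chart. destruct Z_le_dec; [|lia]. f_equal; lia.
  - exists v, (snext c), (Z.of_nat k - Z.of_nat (fst pr))%Z. repeat split; [auto|lia|].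
    unfold local_chart. destruct Z_le_dec; [lia|].
    replace (sprev (snext c)) with c by now destruct c. f_equal; lia.
Qed.

(** Seen from a nearest crossing point the path starts within [R / 2] of the centre, and a word
    shorter than [R / 2] cannot leave the chart, where it runs as on [bool * Z]. *)
Lemma short_relations pr w :
  (2 * length w < fst pr)%nat -> (forall x, runL w x = x) ->
  forall x, runX pr w x = x.
Proof.
  intros Hw HL x. destruct (valid_dec pr x) as [V|V]; [|now apply runX_invalid].
  destruct (local_chart_onto pr x V) as (v & c & z & Hv & Hz & ->).
  rewrite <- local_chart_run by (auto; lia). now rewrite HL.
Qed.

Corollary short_equal pr u w :
  (2 * (length u + length w) < fst pr)%nat -> (forall x, runL u x = runL w x) ->
  forall x, runX pr u x = runX pr w x.
Proof.
  intros H HL x.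
  assert (K : runX pr (u ++ winv w) x = x).
  { apply short_relations.
    - rewrite length_app, winv_length. lia.
    - intros y. rewrite fold_left_app, HL. apply run_winvK, actLK. }
  rewrite fold_left_app in K. rewrite <- K at 2.
  symmetry. apply run_Kwinv, actXK.
Qed.

(** * The group and the step distribution *)

Section Group.
Variable p : nat -> nat * nat.

Definition weq (u w : word) : Prop :=
  (forall x, runL u x = runL w x) /\ (forall j x, runX (p j) u x = runX (p j) w x).

Definition transf (w : word) : (bool * Z -> bool * Z) * (nat -> vertex -> vertex) :=
  (runL w, fun j => runX (p j) w).

(** Elements are the transformations given by words rather than classes of words, so that Leibniz
    equality is equality in the group. *)
Definition elt := {f | exists w, f = transf w}.
Definition mk (w : word) : elt := exist _ (transf w) (ex_intro _ w eq_refl).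
Definition repr (g : elt) : word :=
  proj1_sig (constructive_indefinite_description _ (proj2_sig g)).

Lemma mk_repr g : mk (repr g) = g.
Proof.
  unfold repr. destruct constructive_indefinite_description as [w Hw]; simpl.
  destruct g as [f Hf]; simpl in Hw; subst. unfold mk. f_equal. apply proof_irrelevance.
Qed.

Lemma mk_eq u w : mk u = mk w <-> weq u w.
Proof.
  split.
  - intros H. apply (f_equal (@proj1_sig _ _)) in H. simpl in H. unfold transf in H.
    injection H as H1 H2. split.
    + intros x. now rewrite H1.
    + intros j x. now rewrite (f_equal (fun f => f j x) H2).
  - intros [H1 H2]. assert (E : transf u = transf w).
    { unfold transf. f_equal.
      - apply functional_extensionality, H1.
      - apply functional_extensionality; intros j.
        apply functional_extensionality, H2. }
    unfold mk. revert E. generalize (ex_intro (fun v => transf u = transf v) u eq_refl).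
    generalize (ex_intro (fun v => transf w = transf v) w eq_refl).
    intros a b E. revert a b. rewrite E. intros. f_equal. apply proof_irrelevance.
Qed.

Lemma weq_refl w : weq w w.
Proof. now split. Qed.
Lemma weq_sym u w : weq u w -> weq w u.
Proof. now intros [H1 H2]; split. Qed.
Lemma weq_trans u v w : weq u v -> weq v w -> weq u w.
Proof. intros [H1 H2] [H3 H4]; split; intros; [rewrite H1|rewrite H2]; auto. Qed.
Lemma weq_app u u' w w' : weq u u' -> weq w w' -> weq (u ++ w) (u' ++ w').
Proof.
  intros [H1 H2] [H3 H4]; split; intros; rewrite !fold_left_app.
  - now rewrite H1, H3.
  - now rewrite H2, H4.
Qed.
Lemma weq_winv_l w : weq (winv w ++ w) [].
Proof.
  split; intros; rewrite fold_left_app; simpl.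
  - apply run_Kwinv, actLK.
  - apply run_Kwinv, actXK.
Qed.
Lemma weq_winv u w : weq u w -> weq (winv u) (winv w).
Proof.
  intros H. apply weq_trans with (winv u ++ (w ++ winv w)).
  - rewrite <- (app_nil_r (winv u)) at 1. apply weq_app; [apply weq_refl|].
    apply weq_sym. rewrite <- (winvK w) at 1. apply weq_winv_l.
  - rewrite app_assoc. change (winv w) with ([] ++ winv w) at 2.
    apply weq_app; [|apply weq_refl].
    apply weq_trans with (winv u ++ u); [|apply weq_winv_l].
    apply weq_app; [apply weq_refl|apply weq_sym, H].
Qed.

Lemma weq_repr w : weq (repr (mk w)) w.
Proof. apply mk_eq, mk_repr. Qed.

Definition emul (g h : elt) : elt := mk (repr g ++ repr h).
Definition einv (g : elt) : elt := mk (winv (repr g)).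

Lemma mk_app u w : emul (mk u) (mk w) = mk (u ++ w).
Proof. apply mk_eq, weq_app; apply weq_repr. Qed.
Lemma mk_winv w : einv (mk w) = mk (winv w).
Proof. apply mk_eq, weq_winv, weq_repr. Qed.

Definition Delta : Grp.
Proof.
  refine {| carrier := elt; gmul := emul; ginv := einv; gone := mk [] |}.
  - intros x y z. rewrite <- (mk_repr x), <- (mk_repr y), <- (mk_repr z).
    now rewrite !mk_app, app_assoc.
  - intros x. rewrite <- (mk_repr x). now rewrite mk_app.
  - intros x. rewrite <- (mk_repr x). rewrite mk_winv, mk_app. apply mk_eq, weq_winv_l.
  - intros x y. apply excluded_middle_informative.
Defined.

Definition steps : list word :=
  [[Lt]; [La; Lt]; [Lt; La]; [La; Lt; La]; [LT]; [La; LT]; [LT; La]; [La; LT; La]].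

Definition supp : list Delta := map mk steps.
Definition mu (g : Delta) : R := if excluded_middle_informative (In g supp) then 1/8 else 0.

Lemma NoDup_supp : NoDup supp.
Proof.
  (* The images of three points of [bool * Z] already separate the eight steps. *)
  apply (NoDup_map_inv (fun g => let f := fst (proj1_sig g) in
    (f (false, 0%Z), f (false, 1%Z), f (false, (-1)%Z)))).
  unfold supp. rewrite map_map.
  match goal with |- NoDup ?l => let l' := eval vm_compute in l in change (NoDup l') end.
  repeat constructor; simpl; intuition discriminate.
Qed.

Lemma mu_supp g : In g supp -> mu g = 1/8.
Proof. intros H. unfold mu. destruct excluded_middle_informative; tauto. Qed.

Lemma supp_inv g : In g supp -> In (einv g) supp.
Proof.
  intros H. apply in_map_iff in H. destruct H as (w & <- & Hw).
  rewrite mk_winv. unfold supp. apply in_map.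
  unfold steps in *; simpl in Hw.
  destruct Hw as [<-|[<-|[<-|[<-|[<-|[<-|[<-|[<-|[]]]]]]]]]; simpl; tauto.
Qed.

Lemma gprod_mk (ws : list word) :
  gprod Delta (map mk ws) = mk (concat ws).
Proof.
  induction ws as [|w ws IH]; [reflexivity|].
  change (emul (mk w) (gprod Delta (map mk ws)) = mk (w ++ concat ws)).
  rewrite IH. apply mk_app.
Qed.

Lemma sym_fin_prob_mu : sym_fin_prob Delta mu supp.
Proof.
  repeat split.
  - apply NoDup_supp.
  - intros g H. rewrite mu_supp; auto. lra.
  - intros g H. unfold mu. destruct excluded_middle_informative; tauto.
  - simpl. rewrite !mu_supp by (simpl; tauto). lra.
  - intros g. unfold mu. change (ginv Delta g) with (einv g).
    destruct (excluded_middle_informative (In g supp)) as [H|H];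
    destruct excluded_middle_informative as [H'|H']; auto; exfalso.
    + apply H', supp_inv, H.
    + apply H. rewrite <- (mk_repr g). rewrite <- (winvK (repr g)), <- mk_winv.
      apply supp_inv. rewrite <- (mk_repr g), mk_winv in H'. exact H'.
  - intros g.
    (* The switch is not itself a step, but [a = (a t) t^(-1)]. *)
    pose (code l := match l with Lt => [[Lt]] | LT => [[LT]] | La => [[La; Lt]; [LT]] end).
    assert (Hin : forall l s, In s (code l) -> In s steps).
    { intros l s. destruct l; simpl; intuition. }
    exists (map mk (concat (map code (repr g)))). split.
    + apply Forall_forall. intros x Hx. apply in_map_iff in Hx.
      destruct Hx as (s & <- & Hs). apply in_map.
      apply in_concat in Hs. destruct Hs as (c & Hc & Hs).
      apply in_map_iff in Hc. destruct Hc as (l & <- & _). eauto.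
    + rewrite gprod_mk. rewrite <- (mk_repr g) at 2. apply mk_eq.
      induction (repr g) as [|l w IH]; [apply weq_refl|].
      simpl. rewrite concat_app. change (l :: w) with ([l] ++ w).
      apply weq_app; [|exact IH].
      destruct l; try apply weq_refl.
      apply (weq_app [La] [La] (winv [LT] ++ [LT]) []); [apply weq_refl|apply weq_winv_l].
Qed.

End Group.

(** * Averaging over the walk *)

Definition avg (F : word -> R) (w : word) : R :=
  fold_right Rplus 0 (map (fun s => F (w ++ s)) steps) / 8.

(** The mean of [F] over [w] followed by [n] random steps. Averaging over words instead of group
    elements makes room for functions of the whole path, such as confinement of the cursor. *)
Fixpoint Ew (n : nat) (F : word -> R) (w : word) : R :=
  match n with O => F w | S m => avg (Ew m F) w end.

Lemma walk_sum_Ew p n f w :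
  walk_sum (Delta p) (mu p) (supp p) n f (mk p w) = Ew n (fun u => f (mk p u)) w.
Proof.
  revert w. induction n as [|n IH]; intros w; [reflexivity|].
  simpl. rewrite !mu_supp by (simpl; tauto). rewrite !mk_app, !IH.
  unfold avg. simpl. lra.
Qed.

Lemma avg_mono F G w :
  (forall s, In s steps -> F (w ++ s) <= G (w ++ s)) -> avg F w <= avg G w.
Proof.
  intros H. unfold avg. apply Rmult_le_compat_r; [lra|].
  induction steps as [|s l IH]; simpl; [lra|].
  apply Rplus_le_compat; [apply H; simpl; auto|apply IH; intros; apply H; simpl; auto].
Qed.

Lemma avg_ext F G w :
  (forall s, In s steps -> F (w ++ s) = G (w ++ s)) -> avg F w = avg G w.
Proof. intros H. apply Rle_antisym; apply avg_mono; intros; rewrite H; auto; lra. Qed.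

Lemma steps_length s : In s steps -> (length s <= 3)%nat.
Proof. simpl. intuition (subst; simpl; lia). Qed.

(** A step has at most three letters, so only words of bounded length are reached; bounds that fail
    for long words can still be averaged. *)
Lemma Ew_mono_len n F G w :
  (forall u, (length u <= length w + 3 * n)%nat -> F u <= G u) -> Ew n F w <= Ew n G w.
Proof.
  revert w. induction n as [|n IH]; intros w H; simpl; [apply H; lia|].
  apply avg_mono. intros s Hs. apply IH. intros u Hu. apply H.
  rewrite length_app in Hu. apply steps_length in Hs. lia.
Qed.

Lemma Ew_mono n F G w : (forall u, F u <= G u) -> Ew n F w <= Ew n G w.
Proof. intros H. apply Ew_mono_len; auto. Qed.

Lemma Ew_ext n F G w : (forall u, F u = G u) -> Ew n F w = Ew n G w.
Proof. intros H. apply Rle_antisym; apply Ew_mono; intros; rewrite H; lra. Qed.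

Lemma Ew_lin n a b F G w :
  Ew n (fun u => a * F u + b * G u) w = a * Ew n F w + b * Ew n G w.
Proof.
  revert w. induction n as [|n IH]; intros w; simpl; [reflexivity|].
  unfold avg. simpl. rewrite !IH. lra.
Qed.

Lemma Ew_scal n a F w : Ew n (fun u => a * F u) w = a * Ew n F w.
Proof.
  rewrite (Ew_ext n _ (fun u => a * F u + 0 * F u)) by (intros; lra).
  rewrite Ew_lin. lra.
Qed.

Lemma Ew_const n c w : Ew n (fun _ => c) w = c.
Proof.
  revert w. induction n as [|n IH]; intros w; simpl; [reflexivity|].
  unfold avg. simpl. rewrite !IH. lra.
Qed.

Lemma Ew_nonneg n F w : (forall u, 0 <= F u) -> 0 <= Ew n F w.
Proof. intros H. rewrite <- (Ew_const n 0 w). apply Ew_mono, H. Qed.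

Lemma Ew_shift n F w : Ew n F w = Ew n (fun u => F (w ++ u)) [].
Proof.
  revert F w. induction n as [|n IH]; intros F w; simpl; [now rewrite app_nil_r|].
  change (avg (Ew n F) w) with (avg (fun s => Ew n F (w ++ s)) []).
  apply avg_ext. intros s _. simpl. rewrite IH. rewrite (IH (fun u => F (w ++ u))).
  apply Ew_ext. intros. now rewrite app_assoc.
Qed.

Lemma Ew_snoc n F w : Ew (S n) F w = Ew n (avg F) w.
Proof.
  revert w. induction n as [|n IH]; intros w; [reflexivity|].
  change (avg (Ew (S n) F) w = avg (Ew n (avg F)) w).
  apply avg_ext. intros; apply IH.
Qed.

Lemma Ew_add m n F w : Ew (m + n) F w = Ew m (Ew n F) w.
Proof.
  revert w. induction m as [|m IH]; intros w; [reflexivity|].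
  simpl. apply avg_ext. intros; apply IH.
Qed.

Lemma Ew_avg_comm n (F : word -> word -> R) w :
  Ew n (fun u => avg (F u) []) w = avg (fun s => Ew n (fun u => F u s) w) [].
Proof.
  unfold avg. simpl.
  rewrite (Ew_ext n _ (fun u => (/8) * (F u [Lt] + (F u [La; Lt] + (F u [Lt; La] +
    (F u [La; Lt; La] + (F u [LT] + (F u [La; LT] + (F u [LT; La] + (F u [La; LT; La] + 0)))))))))).
  2: intros; lra.
  rewrite Ew_scal.
  assert (P : forall G H, Ew n (fun u => G u + H u) w = Ew n G w + Ew n H w).
  { intros G H. rewrite (Ew_ext n _ (fun u => 1 * G u + 1 * H u)) by (intros; lra).
    rewrite Ew_lin. lra. }
  rewrite !P, Ew_const. lra.
Qed.

(** The set of steps is closed under inversion, and independent identically distributed steps may be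
    read in reverse order. *)
Lemma Ew_winv n F : Ew n (fun u => F (winv u)) [] = Ew n F [].
Proof.
  revert F. induction n as [|n IH]; intros F; [reflexivity|].
  transitivity (avg (fun s => Ew n (fun u => F (u ++ winv s)) []) []).
  - simpl. apply avg_ext. intros s _. simpl. rewrite Ew_shift.
    rewrite <- (IH (fun u => F (u ++ winv s))).
    apply Ew_ext. intros. now rewrite winv_app.
  - rewrite Ew_snoc.
    rewrite (Ew_ext n (avg F) (fun u => avg (fun s => F (u ++ s)) [])) by reflexivity.
    rewrite Ew_avg_comm. unfold avg. simpl. unfold winv; simpl. lra.
Qed.

Lemma Ew_super n F rho w : 0 <= rho ->
  (forall u, (length u <= length w + 3 * n)%nat -> avg F u <= rho * F u) ->
  Ew n F w <= rho ^ n * F w.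
Proof.
  intros Hr. induction n as [|n IH]; intros H; [simpl; lra|].
  rewrite Ew_snoc. apply Rle_trans with (rho * Ew n F w).
  - rewrite <- Ew_scal. apply Ew_mono_len. intros. apply H. lia.
  - simpl. rewrite Rmult_assoc. apply Rmult_le_compat_l; auto.
    apply IH. intros. apply H. lia.
Qed.

Lemma Ew_sub n F rho w : 0 <= rho ->
  (forall u, rho * F u <= avg F u) -> rho ^ n * F w <= Ew n F w.
Proof.
  intros Hr H. induction n as [|n IH]; [simpl; lra|].
  rewrite Ew_snoc. apply Rle_trans with (rho * Ew n F w).
  - simpl. rewrite Rmult_assoc. apply Rmult_le_compat_l; auto.
  - rewrite <- Ew_scal. apply Ew_mono, H.
Qed.

(** * Superharmonic function on the tree of cycles *)

(* Linear interpolation between the crossing points is harmonic inside a segment; the small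
   concave bump makes it strictly superharmonic there, at the expense of part of the gap
   available at the crossing points. *)
Definition bump (r k : R) : R := k * (r - k) / (100 * r ^ 2).

Definition profile (r : R) (c : seg) (k : R) : R :=
  match c with c0 => 1 - k / (4 * r) | c1 => 3/4 | c2 => 3/4 + k / (4 * r) end + bump r k.

(** The profile is 1 at [c0] and 3/4 at [c1] and [c2]; scaling by 3/4 per generation makes the
    values agree at crossing points exchanged by [a]. *)
Definition height (r : R) (x : vertex) : R :=
  let '(v, c, k) := x in (3/4) ^ length v * profile r c (INR k).

Definition root : vertex := ([], c0, 0%nat).

Lemma bump_bounds r k : 2 <= r -> 0 <= k <= r -> 0 <= bump r k <= 1/100.
Proof.
  intros HR [Hk1 Hk2]. unfold bump. split.
  - apply Rmult_le_pos; [nra|]. apply Rlt_le, Rinv_0_lt_compat. nra.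
  - apply Rmult_le_reg_r with (100 * r ^ 2); [nra|].
    unfold Rdiv. rewrite Rmult_assoc, Rinv_l by nra. nra.
Qed.

Lemma profile_bounds r c k : 2 <= r -> 0 <= k <= r -> 3/4 <= profile r c k <= 2.
Proof.
  intros HR Hk. pose proof (bump_bounds r k HR Hk).
  assert (0 <= k / (4 * r) <= 1/4).
  { split; [apply Rmult_le_pos; [lra|apply Rlt_le, Rinv_0_lt_compat; lra]|].
    apply Rmult_le_reg_r with (4 * r); [lra|].
    unfold Rdiv. rewrite Rmult_assoc, Rinv_l by lra. lra. }
  unfold profile. destruct c; lra.
Qed.

Section Height.
Variable pr : nat * nat.
Hypothesis HR : (2 <= fst pr)%nat.
Notation R0 := (INR (fst pr)).

Lemma R0_ge2 : 2 <= R0.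
Proof. apply (le_INR 2), HR. Qed.

Lemma profile_wrap c : profile R0 c R0 = profile R0 (snext c) 0.
Proof. pose proof R0_ge2. destruct c; unfold profile, bump; simpl; field; lra. Qed.

Lemma height_pos x : valid pr x -> 0 < height R0 x.
Proof.
  destruct x as [[v c] k]. intros [_ H]; simpl in H. unfold height.
  apply Rmult_lt_0_compat; [apply pow_lt; lra|].
  pose proof (profile_bounds R0 c (INR k) R0_ge2
    (conj (pos_INR k) (le_INR _ _ (Nat.lt_le_incl _ _ H)))). lra.
Qed.

Lemma height_La x : height R0 (actX pr La x) = height R0 x.
Proof.
  unfold actX. destruct (valid_dec pr x) as [V|]; [|reflexivity].
  destruct x as [[v c] [|k]]; [|reflexivity].
  pose proof R0_ge2.
  destruct v as [|[] v'], c; simpl; try destruct lt_dec; simpl;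
  unfold profile, bump; field; lra.
Qed.

Lemma height_Lt v c k : valid pr (v, c, k) ->
  height R0 (actX pr Lt (v, c, k)) = (3/4) ^ length v * profile R0 c (INR k + 1).
Proof.
  intros V. unfold actX. destruct (valid_dec pr (v, c, k)) as [_|]; [|tauto].
  destruct (Nat.eq_dec (S k) (fst pr)) as [E|E]; unfold height.
  - rewrite <- S_INR, E, profile_wrap. reflexivity.
  - now rewrite S_INR.
Qed.

Lemma height_LT_pos v c k : valid pr (v, c, S k) ->
  height R0 (actX pr LT (v, c, S k)) = (3/4) ^ length v * profile R0 c (INR (S k) - 1).
Proof.
  intros V. unfold actX. destruct (valid_dec pr (v, c, S k)) as [_|]; [|tauto].
  unfold height. do 2 f_equal. rewrite S_INR. lra.
Qed.

Lemma height_LT_0 v c : valid pr (v, c, 0%nat) ->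
  height R0 (actX pr LT (v, c, 0%nat)) = (3/4) ^ length v * profile R0 (sprev c) (R0 - 1).
Proof.
  intros V. unfold actX. destruct (valid_dec pr (v, c, 0%nat)) as [_|]; [|tauto].
  unfold height. do 2 f_equal. destruct (fst pr); [lia|]. rewrite S_INR. simpl. lra.
Qed.

Definition spread (x : vertex) : R :=
  height R0 (actX pr Lt x) + height R0 (actX pr LT x).

(** The linear part is harmonic and the second difference of the bump is [-2 / (100 R^2)]. As the
    profile is at most 2, this is a relative loss of at least [1 / (200 R^2)]. *)
Lemma spread_interior v c k : valid pr (v, c, S k) ->
  spread (v, c, S k) <= 2 * (1 - 1 / (200 * R0 ^ 2)) * height R0 (v, c, S k).
Proof.
  intros V. unfold spread. rewrite height_Lt, height_LT_pos by auto. unfold height.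
  pose proof R0_ge2 as HR0.
  assert (Hk : 0 <= INR (S k) <= R0).
  { destruct V as [_ V]; simpl in V. split; [apply pos_INR|]. apply le_INR. lia. }
  pose proof (profile_bounds R0 c (INR (S k)) HR0 Hk) as B.
  assert (E : profile R0 c (INR (S k) + 1) + profile R0 c (INR (S k) - 1) =
              2 * profile R0 c (INR (S k)) - 2 / (100 * R0 ^ 2)).
  { unfold profile, bump. destruct c; field; lra. }
  rewrite <- Rmult_plus_distr_l, E.
  assert (0 < (3/4) ^ length v) by (apply pow_lt; lra).
  assert (0 < / (R0 ^ 2)) by (apply Rinv_0_lt_compat; nra).
  replace (2 / (100 * R0 ^ 2)) with (/ R0 ^ 2 * (2 / 100)) by (field; lra).
  replace (1 / (200 * R0 ^ 2)) with (/ R0 ^ 2 * (1 / 200)) by (field; lra).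
  assert (0 <= / R0 ^ 2 * (3/4) ^ length v * (2 - profile R0 c (INR (S k)))).
  { apply Rmult_le_pos; [apply Rmult_le_pos|]; lra. }
  lra.
Qed.

Lemma spread_crossing v c : valid pr (v, c, 0%nat) ->
  spread (v, c, 0%nat) = (3/4) ^ length v *
   (match c with c0 => 2 - 1 / (2 * R0) | _ => 3/2 + 1 / (4 * R0) end
    + (R0 - 1) / (50 * R0 ^ 2)).
Proof.
  intros V. unfold spread. rewrite height_Lt, height_LT_0 by auto.
  pose proof R0_ge2. rewrite <- Rmult_plus_distr_l. f_equal.
  unfold profile, bump. destruct c; simpl; field; lra.
Qed.

(** With [i = 1/R], and in units of [u], the linear parts lose [3 i / 8] on the child's cycle and
    gain [i / 4] on the parent's. The net loss [i / 8] pays for the bump, at most [7 i / 200], and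
    for the required gap [3 i^2 / 200]. *)
Lemma crossing_gap : forall u, 0 < u ->
  u * (3/4) * (2 - 1 / (2 * R0) + (R0 - 1) / (50 * R0 ^ 2)) +
  u * (3/2 + 1 / (4 * R0) + (R0 - 1) / (50 * R0 ^ 2)) <=
  4 * (1 - 1 / (200 * R0 ^ 2)) * (u * (3/4)).
Proof.
  intros u Hu. pose proof R0_ge2.
  set (i := / R0).
  assert (Hi : i * R0 = 1) by (unfold i; apply Rinv_l; lra).
  assert (Hi0 : 0 < i <= 1/2).
  { split; [apply Rinv_0_lt_compat; lra|]. nra. }
  replace (1 / (2 * R0)) with (i / 2) by (unfold i; field; lra).
  replace (1 / (4 * R0)) with (i / 4) by (unfold i; field; lra).
  replace ((R0 - 1) / (50 * R0 ^ 2)) with ((i - i ^ 2) / 50) by (unfold i; field; lra).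
  replace (1 / (200 * R0 ^ 2)) with (i ^ 2 / 200) by (unfold i; field; lra).
  nra.
Qed.

(** The first switch of a step replaces [x] by [a x] with probability 1/2 and the last one does not
    change the height, so a step averages over the cycle neighbours of [x] and of [a x]. Below depth
    [D] the crossing points [c1] and [c2] do have partners. *)
Lemma spread_super x : valid pr x -> (length (fst (fst x)) < snd pr)%nat ->
  (spread x + spread (actX pr La x)) / 4 <=
  (1 - 1 / (200 * R0 ^ 2)) * height R0 x.
Proof.
  intros V HD. destruct x as [[v c] [|k]].
  2:{ assert (actX pr La (v, c, S k) = (v, c, S k)) as ->.
      { unfold actX. now destruct valid_dec. }
      pose proof (spread_interior v c k V). lra. }
  pose proof R0_ge2. pose proof V as [_ V2]. simpl in V2, HD.
  assert (X : actX pr La (v, c, 0%nat) = (cross (snd pr) v c, 0%nat)).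
  { unfold actX. now destruct valid_dec. }
  pose proof (actX_valid pr La _ V) as V'. rewrite X in *.
  assert (child : forall b v, valid pr (b :: v, c0, 0%nat) -> forall c, c <> c0 ->
    valid pr (v, c, 0%nat) ->
    spread (b :: v, c0, 0%nat) + spread (v, c, 0%nat) <=
    4 * (1 - 1 / (200 * R0 ^ 2)) * ((3/4) ^ length v * (3/4))).
  { clear v c V X V' HD. intros b v V1 c Hc V3.
    rewrite !spread_crossing by auto.
    pose proof (crossing_gap ((3/4) ^ length v)) as G.
    assert (0 < (3/4) ^ length v) by (apply pow_lt; lra).
    specialize (G H0).
    change ((3/4) ^ length (b :: v)) with (3/4 * (3/4) ^ length v).
    destruct c; [tauto| |]; lra. }
  destruct c; simpl cross in *.
  - destruct v as [|b v].
    (* The crossing point [c0] of the root is its own partner, and both of its neighbours on the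
       cycle are lower. *)
    + rewrite spread_crossing by auto. simpl.
      unfold profile, bump.
      set (i := / R0).
      assert (Hi : i * R0 = 1) by (unfold i; apply Rinv_l; lra).
      assert (Hi0 : 0 < i <= 1/2).
      { split; [apply Rinv_0_lt_compat; lra|]. nra. }
      replace (1 / (2 * R0)) with (i / 2) by (unfold i; field; lra).
      replace ((R0 - 1) / (50 * (R0 * (R0 * 1)))) with ((i - i ^ 2) / 50) by (unfold i; field; lra).
      replace (1 / (200 * (R0 * (R0 * 1)))) with (i ^ 2 / 200) by (unfold i; field; lra).
      unfold Rdiv. nra.
    + assert (E : height R0 (b :: v, c0, 0%nat) = (3/4) ^ length v * (3/4)).
      { simpl. unfold profile, bump. field. lra. }
      rewrite E. specialize (child b v V (if b then c1 else c2)).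
      assert ((if b then c1 else c2) <> c0) by (destruct b; discriminate).
      specialize (child H0 V'). lra.
  - destruct lt_dec; [|tauto].
    assert (E : height R0 (v, c1, 0%nat) = (3/4) ^ length v * (3/4)).
    { simpl. unfold profile, bump. field. lra. }
    rewrite E. specialize (child true v V' c1 ltac:(discriminate) V). lra.
  - destruct lt_dec; [|tauto].
    assert (E : height R0 (v, c2, 0%nat) = (3/4) ^ length v * (3/4)).
    { simpl. unfold profile, bump. field. lra. }
    rewrite E. specialize (child false v V' c2 ltac:(discriminate) V). lra.
Qed.

Lemma height_root : height R0 root = 1.
Proof. pose proof R0_ge2. simpl. unfold profile, bump. field. lra. Qed.

Lemma root_valid : valid pr root.
Proof. split; simpl; lia. Qed.

Lemma depth_run w x :
  (length (fst (fst (runX pr w x))) <= length (fst (fst x)) + length w)%nat.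
Proof.
  revert x. induction w as [|l w IH]; intros x; simpl; [lia|].
  specialize (IH (actX pr l x)).
  assert (length (fst (fst (actX pr l x))) <= S (length (fst (fst x))))%nat; [|lia].
  unfold actX. destruct valid_dec as [V|]; [|lia]. destruct x as [[v c] k].
  destruct l; simpl; [destruct Nat.eq_dec; simpl; lia|destruct k; simpl; lia|].
  destruct k; simpl; [|lia]. destruct v, c; simpl; try destruct lt_dec; simpl; try destruct b; lia.
Qed.

(** A letter changes the depth by at most one, so with [3 n < D] the walk from the root stays off
    the leaves and every step contracts the mean height. *)
Lemma Ew_height n : (3 * n < snd pr)%nat ->
  Ew n (fun w => height R0 (runX pr w root)) [] <= (1 - 1 / (200 * R0 ^ 2)) ^ n.
Proof.
  intros Hn. pose proof R0_ge2.
  assert (G : 0 <= 1 - 1 / (200 * R0 ^ 2)).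
  { assert (1 / (200 * R0 ^ 2) <= 1); [|lra].
    apply Rmult_le_reg_r with (200 * R0 ^ 2); [nra|].
    unfold Rdiv. rewrite Rmult_assoc, Rinv_l; nra. }
  eapply Rle_trans; [apply Ew_super with (rho := 1 - 1 / (200 * R0 ^ 2)); auto|].
  - intros w Hw. simpl length in Hw.
    set (x := runX pr w root).
    assert (V : valid pr x) by apply runX_valid, root_valid.
    assert (HD : (length (fst (fst x)) < snd pr)%nat).
    { pose proof (depth_run w root). fold x in H0. simpl in H0. lia. }
    apply Rle_trans with (2 := spread_super x V HD).
    unfold avg, spread. simpl. rewrite !fold_left_app. simpl. fold x.
    rewrite !height_La. lra.
  - cbv beta. change (runX pr [] root) with root. rewrite height_root. lra.
Qed.

(** The profile takes values in [[3/4, 2]], so a move along a cycle keeps at least 3/8 of the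
    height, and [a] keeps all of it. *)
Lemma height_step l x : valid pr x -> height R0 x / 4 <= height R0 (actX pr l x).
Proof.
  intros V. destruct l; [| |rewrite height_La; pose proof (height_pos x V); lra].
  - destruct x as [[v c] k]. rewrite height_Lt by auto. unfold height.
    destruct V as [_ V]; simpl in V.
    pose proof (profile_bounds R0 c (INR k) R0_ge2
      (conj (pos_INR k) (le_INR _ _ (Nat.lt_le_incl _ _ V)))).
    pose proof (profile_bounds R0 c (INR (S k)) R0_ge2
      (conj (pos_INR _) (le_INR _ _ V))). rewrite S_INR in *.
    assert (0 < (3/4) ^ length v) by (apply pow_lt; lra). nra.
  - destruct x as [[v c] [|k]].
    + rewrite height_LT_0 by auto. unfold height. pose proof R0_ge2.
      pose proof (profile_bounds R0 c (INR 0) R0_ge2 ltac:(simpl; lra)).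
      pose proof (profile_bounds R0 (sprev c) (R0 - 1) R0_ge2 ltac:(lra)).
      assert (0 < (3/4) ^ length v) by (apply pow_lt; lra). nra.
    + rewrite height_LT_pos by auto. unfold height.
      destruct V as [_ V]; simpl in V.
      assert (0 <= INR k) by apply pos_INR.
      assert (INR (S k) <= R0) by (apply le_INR; lia).
      rewrite S_INR in *.
      pose proof (profile_bounds R0 c (INR k + 1) R0_ge2 ltac:(lra)).
      pose proof (profile_bounds R0 c (INR k + 1 - 1) R0_ge2 ltac:(lra)).
      assert (0 < (3/4) ^ length v) by (apply pow_lt; lra). nra.
Qed.

Lemma height_run w : (1/4) ^ length w <= height R0 (runX pr w root).
Proof.
  assert (G : forall x, valid pr x -> (1/4) ^ length w * height R0 x <= height R0 (runX pr w x)).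
  { induction w as [|l w IH]; intros x V; [simpl; lra|].
    apply Rle_trans with ((1/4) ^ length w * height R0 (actX pr l x)).
    - simpl. pose proof (height_step l x V).
      assert (0 < (1/4) ^ length w) by (apply pow_lt; lra). nra.
    - apply IH, actX_valid, V. }
  specialize (G root root_valid).
  rewrite height_root in G. lra.
Qed.

End Height.

(** * Lamp characters and the universal upper bound on return probabilities *)

(** The character of the lamp at [z]: -1 exactly when the word leaves this lamp on. Products of such
    characters over finite sets are the Fourier basis for lamp configurations. *)
Definition lampsign (z : Z) (w : word) : R :=
  if fst (runL w (false, - z)%Z) then -1 else 1.

Fixpoint lampchar (A : list Z) (w : word) : R :=
  match A with [] => 1 | z :: A' => lampsign z w * lampchar A' w end.

Definition site (A : list Z) (i : Z) : R := if in_dec Z.eq_dec i A then -1 else 1.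

Lemma lampsign_move z w l : l <> La -> lampsign z (w ++ [l]) = lampsign z w.
Proof.
  intros H. unfold lampsign. rewrite fold_left_app. rewrite (runL_flip w).
  destruct l; [reflexivity|reflexivity|tauto].
Qed.

Lemma lampsign_flip z w :
  lampsign z (w ++ [La]) = (if Z.eq_dec z (pos w) then -1 else 1) * lampsign z w.
Proof.
  unfold lampsign. rewrite fold_left_app. rewrite (runL_flip w). simpl.
  destruct (Z.eq_dec (- z + pos w) 0), (Z.eq_dec z (pos w)); try lia;
  destruct (fst (runL w (false, (- z)%Z))); simpl; lra.
Qed.

Lemma lampchar_move A w l : l <> La -> lampchar A (w ++ [l]) = lampchar A w.
Proof.
  intros H. induction A as [|z A IH]; simpl; auto. now rewrite lampsign_move, IH.
Qed.

Lemma lampchar_flip A w : NoDup A ->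
  lampchar A (w ++ [La]) = site A (pos w) * lampchar A w.
Proof.
  induction 1 as [|z A Hz HA IH]; [unfold site; simpl; lra|].
  simpl. rewrite lampsign_flip, IH. unfold site.
  destruct (Z.eq_dec z (pos w)) as [->|Hne].
  - destruct (in_dec Z.eq_dec (pos w) A); [tauto|].
    destruct in_dec as [_|n']; [lra|simpl in n'; tauto].
  - destruct (in_dec Z.eq_dec (pos w) A) as [i|i];
    destruct in_dec as [i'|i']; simpl in i'; try tauto; lra.
Qed.

(* [(1 + site A i) / 2] is the indicator of [i] outside [A], so this is the probability that
   simple random walk started at [i] avoids [A] up to time [n]. *)
Fixpoint survive (A : list Z) (n : nat) (i : Z) : R :=
  match n with
  | O => 1
  | S m => (1 + site A i) / 2 *
     (((1 + site A (i + 1)) / 2 * survive A m (i + 1) +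
       (1 + site A (i - 1)) / 2 * survive A m (i - 1)) / 2)
  end.

(** The switches before and after each move are fair coins, so the character averages to zero as
    soon as the cursor meets a site of [A] at either end of a move. What remains is an avoidance
    probability. *)
Lemma Ew_lampchar A n w : NoDup A ->
  Ew n (lampchar A) w = lampchar A w * survive A n (pos w).
Proof.
  intros HA. revert w. induction n as [|n IH]; intros w; [simpl; lra|].
  simpl Ew. rewrite (avg_ext _ (fun u => lampchar A u * survive A n (pos u))) by auto.
  unfold avg. simpl.
  assert (E2 : forall l k, w ++ [l; k] = (w ++ [l]) ++ [k])
    by (intros; now rewrite <- app_assoc).
  assert (E3 : forall l k j, w ++ [l; k; j] = ((w ++ [l]) ++ [k]) ++ [j])
    by (intros; now rewrite <- !app_assoc).
  rewrite !E3, !E2, !pos_app.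
  rewrite !lampchar_flip by auto.
  rewrite !(lampchar_move _ _ Lt), !(lampchar_move _ _ LT) by discriminate.
  rewrite !lampchar_flip by auto. rewrite !pos_app. simpl pos.
  replace (pos w + 0)%Z with (pos w) by lia.
  replace (pos w + (1 + 0))%Z with (pos w + 1)%Z by lia.
  change (-1 + 0)%Z with (-1)%Z. change (pos w + -1)%Z with (pos w - 1)%Z.
  replace (pos w + 1 + 0)%Z with (pos w + 1)%Z by lia.
  replace (pos w - 1 + 0)%Z with (pos w - 1)%Z by lia.
  field.
Qed.

Lemma site_cases A i : site A i = -1 \/ site A i = 1.
Proof. unfold site. destruct in_dec; auto. Qed.

Lemma survive_bounds A n i : 0 <= survive A n i <= 1.
Proof.
  revert i. induction n as [|n IH]; intros i; simpl; [lra|].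
  pose proof (IH (i + 1)%Z). pose proof (IH (i - 1)%Z).
  destruct (site_cases A i) as [-> | ->], (site_cases A (i + 1)) as [-> | ->],
    (site_cases A (i - 1)) as [-> | ->]; lra.
Qed.

(* [3 s^2 - i^2] is superharmonic with a gap on [-s, s]. *)
Lemma survive_trapped A s z1 z2 n i : (1 <= s)%nat -> In z1 A -> In z2 A ->
  (- Z.of_nat s <= z2 <= i)%Z -> (i <= z1 <= Z.of_nat s)%Z ->
  survive A n i <=
    (1 - 1 / (3 * INR s ^ 2)) ^ n * ((3 * INR s ^ 2 - IZR i ^ 2) / (2 * INR s ^ 2)).
Proof.
  intros Hs H1 H2. assert (HS : 1 <= INR s) by (apply (le_INR 1), Hs).
  set (S2 := INR s ^ 2). assert (HS2 : 1 <= S2) by (unfold S2; nra).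
  assert (Hk : 1 / (3 * S2) * (3 * S2) = 1) by (field; lra).
  set (k := 1 / (3 * S2)) in *.
  assert (Hk0 : 0 <= k <= 1/3) by nra.
  assert (Hsq : forall i, (- Z.of_nat s <= i <= Z.of_nat s)%Z -> 0 <= IZR i ^ 2 <= S2).
  { intros j [Hj1 Hj2]. apply IZR_le in Hj1, Hj2. rewrite opp_IZR in Hj1.
    rewrite <- INR_IZR_INZ in *. unfold S2. nra. }
  revert i. induction n as [|n IH]; intros i Hi1 Hi2.
  - simpl. specialize (Hsq i ltac:(lia)).
    apply Rmult_le_reg_r with (2 * S2); [lra|].
    replace (1 * ((3 * S2 - IZR i * (IZR i * 1)) / (2 * S2)) * (2 * S2))
      with (3 * S2 - IZR i ^ 2) by (field; lra). lra.
  - assert (Hpos : 0 <= (1 - k) ^ n) by (apply pow_le; lra).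
    assert (Hi0 := Hsq i ltac:(lia)).
    set (c := / (2 * S2)). assert (Hc : 0 < c) by (apply Rinv_0_lt_compat; lra).
    simpl. unfold site at 1. destruct (in_dec Z.eq_dec i A) as [Hin|Hin].
    + replace ((1 + -1) / 2) with 0 by lra. rewrite Rmult_0_l.
      apply Rmult_le_pos; [apply Rmult_le_pos; lra|].
      apply Rmult_le_pos; [simpl in Hi0; lra|]. fold c; lra.
    + assert (i <> z1) by (intros ->; tauto). assert (i <> z2) by (intros ->; tauto).
      pose proof (IH (i + 1)%Z ltac:(lia) ltac:(lia)) as I1.
      pose proof (IH (i - 1)%Z ltac:(lia) ltac:(lia)) as I2.
      pose proof (survive_bounds A n (i + 1)). pose proof (survive_bounds A n (i - 1)).
      rewrite plus_IZR in I1. rewrite minus_IZR in I2. unfold Rdiv in I1, I2 |- *.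
      fold c in I1, I2 |- *.
      apply Rle_trans with ((survive A n (i + 1) + survive A n (i - 1)) / 2).
      { destruct (site_cases A (i + 1)) as [-> | ->], (site_cases A (i - 1)) as [-> | ->]; lra. }
      set (x := IZR i) in *.
      (* Averaging [3 s^2 - x^2] over [x + 1] and [x - 1] lowers it by exactly 1, which is at least
         [k = 1 / (3 s^2)] times its value. *)
      apply Rle_trans with ((1 - k) ^ n * c * (3 * S2 - x ^ 2 - 1)); [lra|].
      assert (0 <= (1 - k) ^ n * c) by (apply Rmult_le_pos; lra).
      replace ((1 - k) * (1 - k) ^ n * ((3 * S2 - x * (x * 1)) * c))
        with ((1 - k) ^ n * c * ((1 - k) * (3 * S2 - x ^ 2))) by ring.
      apply Rmult_le_compat_l; auto. nra.
Qed.

Fixpoint lampsoff (zs : list Z) (w : word) : R :=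
  match zs with [] => 1 | z :: zs' => (1 + lampsign z w) / 2 * lampsoff zs' w end.

(** The mean of [Phi] over [A] enlarged by a uniformly random subset of [zs]. It arises by
    multiplying out the factors [(1 + lampsign z) / 2]. *)
Fixpoint expand (Phi : list Z -> R) (zs A : list Z) : R :=
  match zs with
  | [] => Phi A
  | z :: zs' => (expand Phi zs' A + expand Phi zs' (z :: A)) / 2
  end.

Lemma expand_app Phi l1 l2 A : expand Phi (l1 ++ l2) A = expand (expand Phi l2) l1 A.
Proof. revert A. induction l1 as [|z l IH]; intros A; simpl; [auto|now rewrite !IH]. Qed.

Lemma Ew_lampsoff n zs A w :
  Ew n (fun u => lampsoff zs u * lampchar A u) w =
  expand (fun A' => Ew n (lampchar A') w) zs A.
Proof.
  revert A. induction zs as [|z zs IH]; intros A; simpl.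
  - apply Ew_ext. intros; lra.
  - rewrite <- !IH.
    rewrite (Ew_ext n _ (fun u => /2 * (lampsoff zs u * lampchar A u) +
                                 /2 * (lampsoff zs u * lampchar (z :: A) u))).
    + rewrite Ew_lin. lra.
    + intros u. simpl. lra.
Qed.

Lemma expand_le Phi zs A K : NoDup (zs ++ A) ->
  (forall B, NoDup B -> incl A B -> incl B (zs ++ A) -> Phi B <= K) ->
  expand Phi zs A <= K.
Proof.
  revert A. induction zs as [|z zs IH]; intros A HN H; simpl.
  - apply H; auto using incl_refl.
  - assert (expand Phi zs A <= K).
    { apply IH; [now inversion HN|]. intros B H1 H2 H3. apply H; auto.
      intros x Hx. right. auto. }
    assert (expand Phi zs (z :: A) <= K); [|lra].
    apply IH.
    + apply (NoDup_Add (a := z) (l := zs ++ A)); [apply Add_app|]. inversion HN; auto.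
    + intros B H1 H2 H3. apply H; auto.
      * intros x Hx. apply H2. now right.
      * intros x Hx. apply H3 in Hx. rewrite in_app_iff in Hx. simpl in *.
        rewrite in_app_iff. intuition.
Qed.

(** The random subset of [zs] is empty with probability [1 / 2^length zs]; in all other cases the
    bound [K] applies. *)
Lemma expand_bound Phi zs A c K : NoDup (zs ++ A) -> 0 <= K ->
  (forall B, NoDup B -> incl A B -> incl B (zs ++ A) -> Phi B <= c) ->
  (forall B z, NoDup B -> incl A B -> incl B (zs ++ A) -> In z zs -> In z B -> Phi B <= K) ->
  expand Phi zs A <= c / 2 ^ length zs + K.
Proof.
  revert A. induction zs as [|z zs IH]; intros A HN HK Hc H; simpl.
  - specialize (Hc A HN (incl_refl _) (incl_refl _)). lra.
  - assert (H1 : expand Phi zs A <= c / 2 ^ length zs + K).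
    { apply IH; auto; [now inversion HN| |].
      - intros B H1 H2 H3. apply Hc; auto. intros x Hx. right; auto.
      - intros B y H1 H2 H3 H4 H5. apply H with y; auto.
        + intros x Hx. right; auto.
        + now right. }
    assert (H2 : expand Phi zs (z :: A) <= K).
    { apply expand_le.
      - apply (NoDup_Add (a := z) (l := zs ++ A)); [apply Add_app|]. inversion HN; auto.
      - intros B H2 H3 H4. apply H with z; auto.
        + intros x Hx. apply H3. now right.
        + intros x Hx. apply H4 in Hx. rewrite in_app_iff in Hx. simpl in *.
          rewrite in_app_iff. intuition.
        + now left.
        + apply H3. now left. }
    replace (c / (2 * 2 ^ length zs)) with (c / 2 ^ length zs / 2); [lra|].
    field. apply pow_nonzero. lra.
Qed.

Lemma lampsoff_nonneg zs w : 0 <= lampsoff zs w.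
Proof.
  induction zs as [|z zs IH]; simpl; [lra|].
  apply Rmult_le_pos; auto. unfold lampsign. destruct fst; lra.
Qed.

Lemma lampsoff_trivial zs w : (forall x, runL w x = x) -> lampsoff zs w = 1.
Proof.
  intros H. induction zs as [|z zs IH]; simpl; [lra|].
  unfold lampsign. rewrite H, IH. simpl. lra.
Qed.

(** A random subset of the [s] sites on each side of the origin misses a whole side with probability
    at most [2 / 2^s]. Otherwise a cursor avoiding it is trapped between two sites of [[-s, s]], and
    the trapping bound at 0 has prefactor 3/2. *)
Lemma lampsoff_bound n s : (1 <= s)%nat ->
  exists zs, Ew n (lampsoff zs) [] <= 2 / 2 ^ s + 3/2 * (1 - 1 / (3 * INR s ^ 2)) ^ n.
Proof.
  intros Hs.
  set (right := map Z.of_nat (seq 1 s)).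
  set (left := map (fun k => - Z.of_nat k)%Z (seq 1 s)).
  assert (Hr : forall z, In z right -> (1 <= z <= Z.of_nat s)%Z).
  { intros z Hz. apply in_map_iff in Hz. destruct Hz as (k & <- & Hk).
    apply in_seq in Hk. lia. }
  assert (Hl : forall z, In z left -> (- Z.of_nat s <= z <= -1)%Z).
  { intros z Hz. apply in_map_iff in Hz. destruct Hz as (k & <- & Hk).
    apply in_seq in Hk. lia. }
  assert (NR : NoDup right).
  { apply FinFun.Injective_map_NoDup; [intros a b ?; lia|apply seq_NoDup]. }
  assert (NL : NoDup left).
  { apply FinFun.Injective_map_NoDup; [intros a b ?; lia|apply seq_NoDup]. }
  assert (Lr : length right = s) by (unfold right; now rewrite length_map, length_seq).
  assert (Ll : length left = s) by (unfold left; now rewrite length_map, length_seq).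
  assert (NLB : forall B, NoDup B -> incl B right -> NoDup (left ++ B)).
  { intros B HB1 HB2. apply NoDup_app; auto. intros z Hz1 Hz2.
    apply Hl in Hz1. apply HB2, Hr in Hz2. lia. }
  assert (HS : 1 <= INR s) by (apply (le_INR 1), Hs).
  assert (HS2 : 1 <= INR s ^ 2) by nra.
  assert (Hk : 0 <= 1 / (3 * INR s ^ 2) <= 1).
  { assert (1 / (3 * INR s ^ 2) * (3 * INR s ^ 2) = 1) by (field; lra). nra. }
  assert (HP : 0 <= (1 - 1 / (3 * INR s ^ 2)) ^ n) by (apply pow_le; lra).
  assert (H2s : 0 < / 2 ^ s) by (apply Rinv_0_lt_compat, pow_lt; lra).
  assert (Phi1 : forall B, NoDup B -> Ew n (lampchar B) [] <= 1).
  { intros B HB. rewrite Ew_lampchar by auto.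
    replace (lampchar B []) with 1.
    - pose proof (survive_bounds B n (pos [])). lra.
    - clear HB. induction B as [|z B IH]; simpl; [lra|]. rewrite <- IH.
      unfold lampsign; simpl. lra. }
  assert (Phi2 : forall B z1 z2, NoDup B -> In z1 B -> In z2 B -> In z1 right -> In z2 left ->
    Ew n (lampchar B) [] <= 3/2 * (1 - 1 / (3 * INR s ^ 2)) ^ n).
  { intros B z1 z2 HB H1 H2 H3 H4. rewrite Ew_lampchar by auto.
    replace (lampchar B []) with 1.
    - apply Hr in H3. apply Hl in H4.
      pose proof (survive_trapped B s z1 z2 n 0 Hs H1 H2 ltac:(lia) ltac:(lia)) as T.
      simpl pos.
      replace ((3 * INR s ^ 2 - 0 ^ 2) / (2 * INR s ^ 2)) with (3/2) in T by (field; lra).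
      lra.
    - clear - B. induction B as [|z B IH]; simpl; [lra|]. rewrite <- IH.
      unfold lampsign; simpl. lra. }
  exists (right ++ left).
  rewrite (Ew_ext n _ (fun u => lampsoff (right ++ left) u * lampchar [] u)) by (intros; simpl; lra).
  rewrite Ew_lampsoff, expand_app.
  set (K := 1 / 2 ^ s + 3/2 * (1 - 1 / (3 * INR s ^ 2)) ^ n).
  replace (2 / 2 ^ s + 3/2 * (1 - 1 / (3 * INR s ^ 2)) ^ n) with (1 / 2 ^ length right + K)
    by (rewrite Lr; unfold K; lra).
  apply expand_bound.
  - now rewrite app_nil_r.
  - unfold K. lra.
  - intros B H1 _ H2. rewrite app_nil_r in H2. apply expand_le; auto.
  - intros B z H1 _ H2 H3 H4. rewrite app_nil_r in H2.
    unfold K. replace (1 / 2 ^ s) with (1 / 2 ^ length left) by now rewrite Ll.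
    apply expand_bound; auto; [lra|].
    intros C z' C1 C2 C3 C4 C5. apply Phi2 with z z'; auto.
Qed.

Definition ind (P : Prop) : R := if excluded_middle_informative P then 1 else 0.

Lemma ind_bounds P : 0 <= ind P <= 1.
Proof. unfold ind. destruct excluded_middle_informative; lra. Qed.
Lemma ind_true (P : Prop) : P -> ind P = 1.
Proof. unfold ind. destruct excluded_middle_informative; tauto. Qed.
Lemma ind_false (P : Prop) : ~ P -> ind P = 0.
Proof. unfold ind. destruct excluded_middle_informative; tauto. Qed.

(** * The cursor *)

Lemma avg_pos (f : Z -> R) w :
  avg (fun u => f (pos u)) w = (f (pos w + 1)%Z + f (pos w - 1)%Z) / 2.
Proof.
  unfold avg. simpl. rewrite !pos_app. simpl pos. simpl Z.add.
  change (pos w + -1)%Z with (pos w - 1)%Z. field.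
Qed.

Lemma Ew_pos2 n w : Ew n (fun u => IZR (pos u) ^ 2) w = IZR (pos w) ^ 2 + INR n.
Proof.
  revert w. induction n as [|n IH]; intros w; [simpl; lra|].
  cbn [Ew]. rewrite (avg_ext _ (fun u => IZR (pos u) ^ 2 + INR n)) by (intros; apply IH).
  rewrite (avg_pos (fun z => IZR z ^ 2 + INR n)), S_INR, plus_IZR, minus_IZR. field.
Qed.

Lemma Ew_pos4 n w : Ew n (fun u => IZR (pos u) ^ 4) w =
  IZR (pos w) ^ 4 + 6 * INR n * IZR (pos w) ^ 2 + 3 * INR n ^ 2 - 2 * INR n.
Proof.
  revert w. induction n as [|n IH]; intros w; [simpl; lra|].
  set (f := fun z => IZR z ^ 4 + 6 * INR n * IZR z ^ 2 + 3 * INR n ^ 2 - 2 * INR n).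
  cbn [Ew]. rewrite (avg_ext _ (fun u => f (pos u))) by (intros; apply IH).
  rewrite avg_pos. unfold f. rewrite S_INR, plus_IZR, minus_IZR. field.
Qed.

(** The second moment [n] and the fourth moment [3 n^2 - 2 n] force a first absolute moment of order
    [sqrt n]. *)
Lemma Ew_abs_pos n : (1 <= n)%nat ->
  sqrt (INR n) / 4 <= Ew n (fun u => Rabs (IZR (pos u))) [].
Proof.
  intros Hn. apply le_INR in Hn. simpl in Hn.
  set (b := sqrt (INR n)).
  assert (Hb : b * b = INR n) by (apply sqrt_sqrt; lra).
  assert (Hb1 : 0 < b) by (apply sqrt_lt_R0; lra).
  (* [y >= y^2 - y^4 / 4] for [y >= 0], at [y = |pos| / b] *)
  apply Rle_trans with (Ew n (fun u => / b * IZR (pos u) ^ 2 + - / (4 * b ^ 3) * IZR (pos u) ^ 4) []).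
  - rewrite Ew_lin, Ew_pos2, Ew_pos4. simpl pos. rewrite <- Hb.
    match goal with |- _ <= ?e => replace e with (b / 4 + / (2 * b)) by (field; lra) end.
    assert (0 < / (2 * b)) by (apply Rinv_0_lt_compat; lra). lra.
  - apply Ew_mono. intros u. rewrite <- (pow2_abs (IZR (pos u))).
    replace (IZR (pos u) ^ 4) with (Rabs (IZR (pos u)) ^ 4)
      by (replace 4%nat with (2 * 2)%nat by reflexivity; rewrite !pow_mult, pow2_abs; reflexivity).
    set (x := Rabs (IZR (pos u))). assert (Hx : 0 <= x) by apply Rabs_pos.
    set (y := x / b). assert (x = y * b) by (unfold y; field; lra).
    assert (Hy : 0 <= y) by (apply Rmult_le_pos; auto; apply Rlt_le, Rinv_0_lt_compat; auto).
    rewrite H. replace (/ b * (y * b) ^ 2 + - / (4 * b ^ 3) * (y * b) ^ 4)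
      with ((y ^ 2 - y ^ 4 / 4) * b) by (field; lra).
    apply Rmult_le_compat_r; [lra|].
    assert (0 <= y * (1 - y + y ^ 3 / 4)); [|lra].
    apply Rmult_le_pos; auto.
    (* Tangent-line bounds for [y^3] at 1 and at 5/4; the latter makes [1 - y + y^3 / 4]
       positive. *)
    assert (0 <= (y - 1) ^ 2 * (y + 2)) by (apply Rmult_le_pos; [apply pow2_ge_0|lra]).
    assert (0 <= (y - 5/4) ^ 2 * (y + 5/2)) by (apply Rmult_le_pos; [apply pow2_ge_0|lra]).
    nra.
Qed.

Fixpoint stay (s i : Z) (w : word) : Prop :=
  match w with
  | [] => (Z.abs i <= s)%Z
  | l :: w' => (Z.abs i <= s)%Z /\ stay s (i + disp l) w'
  end.

Lemma stay_start s i w : stay s i w -> (Z.abs i <= s)%Z.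
Proof. destruct w; simpl; tauto. Qed.

Lemma stay_end s i w : stay s i w -> (Z.abs (i + pos w) <= s)%Z.
Proof.
  revert i. induction w as [|l w IH]; intros i; simpl.
  - now rewrite Z.add_0_r.
  - intros [_ H]. apply IH in H. now rewrite Z.add_assoc.
Qed.

Lemma stay_app s i u w : stay s i (u ++ w) <-> stay s i u /\ stay s (i + pos u) w.
Proof.
  revert i. induction u as [|l u IH]; intros i; simpl.
  - rewrite Z.add_0_r. split; [|tauto]. intros H; split; auto. now apply stay_start in H.
  - rewrite IH, Z.add_assoc. tauto.
Qed.

Lemma stay_step s w t : In t steps ->
  stay s 0 (w ++ t) <-> stay s 0 w /\ (Z.abs (pos (w ++ t)) <= s)%Z.
Proof.
  intros Ht. rewrite stay_app, pos_app, !Z.add_0_l. split; intros [H1 H2]; split; auto.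
  - now apply stay_end in H2.
  - apply stay_end in H1. rewrite Z.add_0_l in H1. unfold steps in Ht. simpl in Ht.
    destruct Ht as [<-|[<-|[<-|[<-|[<-|[<-|[<-|[<-|[]]]]]]]]]; simpl in *;
    rewrite ?Z.add_0_r; repeat split; lia.
Qed.

(* [(s^2 - i^2)^2] is subharmonic up to the factor [1 - 9/(2 s^2)]. *)
Lemma Ew_stay n s : (3 <= s)%nat ->
  (1 - 9 / (2 * INR s ^ 2)) ^ n <= Ew n (fun w => ind (stay (Z.of_nat s) 0 w)) [].
Proof.
  intros Hs. assert (HS : 3 <= INR s) by (apply (le_INR 3) in Hs; simpl in Hs; lra).
  set (S2 := INR s ^ 2). assert (HS2 : 9 <= S2) by (unfold S2; nra).
  set (f := fun z => (S2 - IZR z ^ 2) ^ 2).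
  assert (Hf : forall z, 0 <= f z) by (intros; apply pow2_ge_0).
  set (F := fun w => ind (stay (Z.of_nat s) 0 w) * f (pos w)).
  set (rho := 1 - 9 / (2 * S2)).
  assert (Hrho : 0 <= rho).
  { unfold rho. assert (9 / (2 * S2) * (2 * S2) = 9) by (field; lra). nra. }
  assert (Hsq : forall z, (Z.abs z <= Z.of_nat s)%Z -> 0 <= IZR z ^ 2 <= S2).
  { intros z Hz. assert (H1 : (- Z.of_nat s <= z)%Z) by lia.
    assert (H2 : (z <= Z.of_nat s)%Z) by lia. apply IZR_le in H1, H2.
    rewrite opp_IZR in H1. rewrite <- INR_IZR_INZ in *. unfold S2. nra. }
  assert (G : rho ^ n * F [] <= Ew n F []).
  { apply Ew_sub; auto. intros u. unfold F at 1.
    assert (Hnn : 0 <= avg F u).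
    { change (avg F u) with (Ew 1 F u). apply Ew_nonneg. intros v.
      apply Rmult_le_pos; [apply ind_bounds|apply Hf]. }
    destruct (classic (stay (Z.of_nat s) 0 u)) as [Hst|Hst].
    2:{ rewrite ind_false by auto. lra. }
    rewrite ind_true by auto. pose proof (stay_end _ _ _ Hst) as He.
    rewrite Z.add_0_l in He.
    destruct (Z.eq_dec (Z.abs (pos u)) (Z.of_nat s)) as [Heq|Hne].
    - replace (f (pos u)) with 0; [lra|]. unfold f.
      assert (E : IZR (pos u) ^ 2 = S2); [|rewrite E; ring].
      unfold S2. rewrite <- pow2_abs, <- abs_IZR, Heq, <- INR_IZR_INZ. reflexivity.
    - rewrite (avg_ext _ (fun v => f (pos v))).
      + rewrite (avg_pos f). unfold f, rho. rewrite plus_IZR, minus_IZR.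
        pose proof (Hsq _ He). set (x := IZR (pos u)) in *.
        (* Completing the square in [x^2] shows that the gain is positive. *)
        assert (K : ((S2 - (x + 1) ^ 2) ^ 2 + (S2 - (x - 1) ^ 2) ^ 2) / 2 -
          (1 - 9 / (2 * S2)) * (1 * (S2 - x ^ 2) ^ 2) =
          ((3 * x ^ 2 - S2) ^ 2 + 4 * S2 ^ 2 + 2 * S2) / (2 * S2)) by (field; lra).
        assert (0 <= ((3 * x ^ 2 - S2) ^ 2 + 4 * S2 ^ 2 + 2 * S2) / (2 * S2)); [|lra].
        apply Rmult_le_pos; [|apply Rlt_le, Rinv_0_lt_compat; lra].
        pose proof (pow2_ge_0 (3 * x ^ 2 - S2)). nra.
      + intros t Ht. unfold F. rewrite ind_true; [lra|].
        apply stay_step; auto. split; auto.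
        rewrite pos_app. unfold steps in Ht; simpl in Ht.
        destruct Ht as [<-|[<-|[<-|[<-|[<-|[<-|[<-|[<-|[]]]]]]]]]; simpl; lia. }
  assert (F0 : F [] = S2 ^ 2).
  { unfold F, f. rewrite ind_true; simpl; [ring|lia]. }
  rewrite F0 in G.
  assert (U : Ew n F [] <= S2 ^ 2 * Ew n (fun w => ind (stay (Z.of_nat s) 0 w)) []).
  { rewrite <- Ew_scal. apply Ew_mono. intros u. unfold F.
    destruct (classic (stay (Z.of_nat s) 0 u)) as [Hst|Hst].
    - rewrite ind_true by auto. pose proof (stay_end _ _ _ Hst) as He.
      rewrite Z.add_0_l in He. apply Hsq in He. unfold f. nra.
    - rewrite ind_false by auto. lra. }
  apply Rmult_le_reg_l with (S2 ^ 2); [nra|]. lra.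
Qed.

(** The mean of [c = 2 cosh (a z)] at the cursor grows by the factor [cosh a] per step. The function
    [G] is frozen at the value [K] of [c] at distance [r + 1], where every exit takes place, and
    [K >= exp (a r)]. *)
Lemma Ew_exit n r a : 0 <= a ->
  Ew n (fun w => ind (~ stay (Z.of_nat r) 0 w)) [] <=
  ((exp a + exp (- a)) / 2) ^ n * 2 * exp (- (a * INR r)).
Proof.
  intros Ha.
  set (c := fun z => exp (a * IZR z) + exp (- (a * IZR z))).
  set (K := c (Z.of_nat r + 1)%Z).
  set (G := fun w => if excluded_middle_informative (stay (Z.of_nat r) 0 w) then c (pos w) else K).
  set (kap := (exp a + exp (- a)) / 2).
  assert (Hc : forall z, 0 < c z) by (intros; unfold c; apply Rplus_lt_0_compat; apply exp_pos).
  assert (Hkap : 1 <= kap).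
  { unfold kap. rewrite exp_Ropp. pose proof (exp_pos a) as H.
    assert (E : (exp a + / exp a) / 2 - 1 = / exp a * (exp a - 1) ^ 2 / 2) by (field; lra).
    assert (0 <= / exp a * (exp a - 1) ^ 2); [|lra].
    apply Rmult_le_pos; [apply Rlt_le, Rinv_0_lt_compat; lra|apply pow2_ge_0]. }
  assert (E : Ew n G [] <= kap ^ n * G []).
  { apply Ew_super; [lra|]. intros u _. unfold G at 2.
    destruct excluded_middle_informative as [Hst|Hst].
    - pose proof (stay_end _ _ _ Hst) as He. rewrite Z.add_0_l in He.
      apply Rle_trans with (avg (fun v => c (pos v)) u).
      + apply avg_mono. intros t Ht. unfold G.
        destruct excluded_middle_informative as [H|H]; [lra|].
        rewrite stay_step in H by auto.
        assert (Habs : Z.abs (pos (u ++ t)) = (Z.of_nat r + 1)%Z).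
        { assert (~ (Z.abs (pos (u ++ t)) <= Z.of_nat r)%Z) by tauto.
          rewrite pos_app in *. unfold steps in Ht; simpl in Ht.
          destruct Ht as [<-|[<-|[<-|[<-|[<-|[<-|[<-|[<-|[]]]]]]]]]; simpl in *; lia. }
        unfold K. rewrite <- Habs. unfold c. rewrite abs_IZR.
        unfold Rabs. destruct Rcase_abs; [|lra].
        replace (a * - IZR (pos (u ++ t))) with (- (a * IZR (pos (u ++ t)))) by ring.
        rewrite Ropp_involutive. lra.
      + rewrite (avg_pos c). unfold c, kap. rewrite plus_IZR, minus_IZR.
        set (x := IZR (pos u)).
        replace (a * (x + 1)) with (a * x + a) by ring.
        replace (a * (x - 1)) with (a * x + - a) by ring.
        replace (- (a * x + a)) with (- (a * x) + - a) by ring.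
        replace (- (a * x + - a)) with (- (a * x) + a) by ring.
        rewrite !exp_plus. apply Req_le. field.
    - apply Rle_trans with (1 * K).
      + rewrite Rmult_1_l. rewrite <- (Ew_const 1 K u). change (avg G u) with (Ew 1 G u).
        apply avg_mono. intros t Ht. simpl. unfold G.
        destruct excluded_middle_informative as [H|H]; [|lra].
        rewrite stay_step in H by auto. tauto.
      + apply Rmult_le_compat_r; [apply Rlt_le, Hc|lra]. }
  assert (G0 : G [] = 2).
  { unfold G. destruct excluded_middle_informative as [H|H]; [|simpl in H; lia].
    unfold c. simpl. rewrite Rmult_0_r, Ropp_0, exp_0. lra. }
  rewrite G0 in E.
  assert (HK : exp (a * INR r) <= K).
  { unfold K, c. rewrite plus_IZR, <- INR_IZR_INZ.
    assert (exp (a * INR r) <= exp (a * (INR r + 1))).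
    { destruct (Req_dec a 0) as [->|]; [rewrite !Rmult_0_l; lra|].
      apply Rlt_le, exp_increasing. lra. }
    pose proof (exp_pos (- (a * (INR r + 1)))). lra. }
  assert (U : exp (a * INR r) * Ew n (fun w => ind (~ stay (Z.of_nat r) 0 w)) [] <= Ew n G []).
  { rewrite <- Ew_scal. apply Ew_mono. intros u. unfold G.
    pose proof (exp_pos (a * INR r)). pose proof (Hc (pos u)).
    destruct excluded_middle_informative as [H1|H1].
    - rewrite ind_false by tauto. lra.
    - rewrite ind_true by tauto. lra. }
  rewrite exp_Ropp. pose proof (exp_pos (a * INR r)) as HP.
  apply Rmult_le_reg_l with (exp (a * INR r)); auto.
  replace (exp (a * INR r) * (kap ^ n * 2 * / exp (a * INR r))) with (kap ^ n * 2) by (field; lra).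
  lra.
Qed.

(** The choice [exp a = 1 + 1/q] keeps [(cosh a)^(q^2)] below 2, while [(1 + 1/q)^q >= 2] turns the
    barrier at [q m] into the factor [2^m]. *)
Lemma Ew_exit_scaled q m : (1 <= q)%nat ->
  Ew (q * q) (fun w => ind (~ stay (Z.of_nat (q * m)) 0 w)) [] <= 4 / 2 ^ m.
Proof.
  intros Hq. assert (HQ : 1 <= INR q) by (apply (le_INR 1), Hq).
  set (la := / INR q).
  assert (Hla : la * INR q = 1) by (apply Rinv_l; lra).
  assert (Hla0 : 0 < la <= 1) by (split; [apply Rinv_0_lt_compat; lra|nra]).
  assert (Ea : exp (ln (1 + la)) = 1 + la) by (apply exp_ln; lra).
  assert (Ha : 0 <= ln (1 + la)).
  { rewrite <- ln_1. apply Rlt_le, ln_increasing; lra. }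
  eapply Rle_trans; [apply (Ew_exit (q * q) (q * m) (ln (1 + la)) Ha)|].
  rewrite exp_Ropp, Ea.
  assert (K : ((1 + la + / (1 + la)) / 2) ^ (q * q) <= 2).
  { apply Rle_trans with (exp (la ^ 2 / 2) ^ (q * q)).
    - apply pow_incr. assert (0 < / (1 + la)) by (apply Rinv_0_lt_compat; lra).
      split; [lra|]. pose proof (exp_ineq1_le (la ^ 2 / 2)).
      assert (/ (1 + la) * (1 + la) = 1) by (apply Rinv_l; lra). nra.
    - rewrite <- Rpower_pow by apply exp_pos. unfold Rpower. rewrite ln_exp.
      rewrite mult_INR. replace (INR q * INR q * (la ^ 2 / 2)) with (1/2) by
        (replace (la ^ 2) with (la * la) by ring; nra).
      pose proof exp_le_3 as E3. replace 1 with (1/2 + 1/2) in E3 by lra.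
      rewrite exp_plus in E3. pose proof (exp_pos (1/2)). nra. }
  assert (M : exp (- (ln (1 + la) * INR (q * m))) <= / 2 ^ m).
  { rewrite exp_Ropp. apply Rinv_le_contravar; [apply pow_lt; lra|].
    rewrite mult_INR.
    replace (exp (ln (1 + la) * (INR q * INR m))) with (((1 + la) ^ q) ^ m).
    - apply pow_incr. split; [lra|].
      clear - Hla Hla0. assert (B : forall k, 1 + INR k * la <= (1 + la) ^ k).
      { induction k as [|k IH]; [simpl; lra|]. rewrite S_INR. simpl.
        assert (0 <= INR k) by apply pos_INR. nra. }
      specialize (B q). lra.
    - rewrite <- pow_mult, <- Rpower_pow by lra. unfold Rpower. f_equal.
      rewrite mult_INR. ring. }
  assert (0 < / 2 ^ m) by (apply Rinv_0_lt_compat, pow_lt; lra).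
  assert (0 <= exp (- (ln (1 + la) * INR (q * m)))) by apply Rlt_le, exp_pos.
  assert (0 <= ((1 + la + / (1 + la)) / 2) ^ (q * q)).
  { apply pow_le. assert (0 < / (1 + la)) by (apply Rinv_0_lt_compat; lra). lra. }
  unfold Rdiv at 2. nra.
Qed.

(** * Finitely many finite factors do not slow down the lamplighter *)

Fixpoint boollists (D : nat) : list (list bool) :=
  match D with
  | O => [[]]
  | S D' => [] :: flat_map (fun v => [true :: v; false :: v]) (boollists D')
  end.

Lemma in_boollists D v : (length v <= D)%nat -> In v (boollists D).
Proof.
  revert v. induction D as [|D IH]; intros [|b v] H; simpl in *; auto; [lia|].
  right. apply in_flat_map. exists v. split; [apply IH; lia|]. destruct b; simpl; auto.
Qed.

Definition verts (pr : nat * nat) : list vertex :=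
  list_prod (list_prod (boollists (snd pr)) [c0; c1; c2]) (seq 0 (fst pr)).

Lemma in_verts pr x : valid pr x -> In x (verts pr).
Proof.
  destruct x as [[v c] k]. intros [H1 H2]; simpl in *.
  apply in_prod; [apply in_prod|].
  - now apply in_boollists.
  - destruct c; simpl; auto.
  - apply in_seq. lia.
Qed.

Lemma verts_eq pr u w : map (runX pr u) (verts pr) = map (runX pr w) (verts pr) ->
  forall x, runX pr u x = runX pr w x.
Proof.
  intros H x. destruct (valid_dec pr x) as [V|V].
  - apply (proj1 map_ext_in_iff H). now apply in_verts.
  - now rewrite !runX_invalid.
Qed.

Fixpoint tuples {A : Type} (Q : list A) (n : nat) : list (list A) :=
  match n with
  | O => [[]]
  | S m => map (fun ql => fst ql :: snd ql) (list_prod Q (tuples Q m))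
  end.

Lemma in_tuples {A : Type} (Q l : list A) : Forall (fun x => In x Q) l ->
  In l (tuples Q (length l)).
Proof.
  induction 1 as [|x l Hx Hl IH]; simpl; auto.
  apply in_map_iff. exists (x, l). split; auto. now apply in_prod.
Qed.

Lemma tuples_length {A : Type} (Q : list A) n : length (tuples Q n) = (length Q ^ n)%nat.
Proof. induction n; simpl; auto. now rewrite length_map, length_prod, IHn. Qed.

(** Tables of the action on the graphs in [ps]: they determine this action, and only finitely many
    tables occur. *)
Definition finvals (ps : list (nat * nat)) (u : word) : list (list vertex) :=
  map (fun pr => map (runX pr u) (verts pr)) ps.

Lemma finvals_eq ps u w : finvals ps u = finvals ps w ->
  forall pr, In pr ps -> forall x, runX pr u x = runX pr w x.
Proof.
  intros H pr Hpr. apply verts_eq. apply (proj1 map_ext_in_iff H pr Hpr).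
Qed.

Lemma finvals_finite ps : exists I, forall u, In (finvals ps u) I.
Proof.
  induction ps as [|pr ps [I HI]]; [exists [[]]; simpl; auto|].
  exists (map (fun ql => fst ql :: snd ql)
    (list_prod (tuples (verts pr) (length (verts pr))) I)).
  intros u. apply in_map_iff. exists (map (runX pr u) (verts pr), finvals ps u).
  split; auto. apply in_prod; auto.
  replace (length (verts pr)) with (length (map (runX pr u) (verts pr))) by apply length_map.
  apply in_tuples.
  apply Forall_forall. intros y Hy. apply in_map_iff in Hy. destruct Hy as (x & <- & Hx).
  destruct (valid_dec pr x) as [V|V]; [apply in_verts, runX_valid, V|].
  now rewrite runX_invalid.
Qed.

(** One word from [P] is kept for each value attained there, and finitely many words have bounded
    length. *)
Lemma finite_short {V : Type} (P : word -> Prop) (phi : word -> V) (I : list V) :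
  exists C, forall u, P u -> In (phi u) I ->
    exists v, P v /\ phi v = phi u /\ (length v <= C)%nat.
Proof.
  induction I as [|c I [C HC]]; [exists 0%nat; simpl; tauto|].
  destruct (classic (exists u, P u /\ phi u = c)) as [(u0 & H0 & E0)|N].
  - exists (Nat.max C (length u0)). intros u Hu [E|Hin].
    + exists u0. repeat split; auto; [congruence|lia].
    + destruct (HC u Hu Hin) as (v & H1 & H2 & H3). exists v. repeat split; auto; lia.
  - exists C. intros u Hu [E|Hin]; auto. exfalso. apply N. exists u. auto.
Qed.

(** Words trivial in the lamplighter group act on the graphs in [ps] in finitely many ways, so short
    words of the same kind realise all of them. This is why finite factors cost only a constant. *)
Lemma kernel_short ps : exists C, forall u, (forall x, runL u x = x) ->
  exists v, (length v <= C)%nat /\ (forall x, runL v x = x) /\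
    forall pr, In pr ps -> forall x, runX pr v x = runX pr u x.
Proof.
  destruct (finvals_finite ps) as [I HI].
  destruct (finite_short (fun u => forall x, runL u x = x) (finvals ps) I) as [C HC].
  exists C. intros u Hu. destruct (HC u Hu (HI u)) as (v & H1 & H2 & H3).
  exists v. repeat split; auto. now apply finvals_eq.
Qed.

(** * Lamp configurations of confined paths and short words producing them *)

Lemma lamp_off s w i j : stay s j w -> (s < Z.abs i)%Z ->
  fst (runL w (false, (j + i)%Z)) = false.
Proof.
  revert j. induction w as [|l w IH]; intros j; [auto|].
  intros [H1 H2] Hi.
  change (fst (runL w (actL l (false, (j + i)%Z))) = false).
  specialize (IH _ H2 Hi).
  destruct l; simpl in *.
  - now replace (j + i + 1)%Z with (j + 1 + i)%Z by lia.
  - now replace (j + i + -1)%Z with (j + -1 + i)%Z by lia.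
  - destruct (Z.eq_dec (j + i) 0); [lia|]. now rewrite Z.add_0_r in IH.
Qed.

(** Lamps outside [[-s, s]] are never visited and stay off, so agreement of the cursor and of the
    lamps inside is enough. *)
Lemma lamps_determine s u w : stay s 0 u -> stay s 0 w -> pos u = pos w ->
  (forall i, (Z.abs i <= s)%Z -> fst (runL u (false, i)) = fst (runL w (false, i))) ->
  forall x, runL u x = runL w x.
Proof.
  intros Hu Hw Hp H [b i]. rewrite (runL_flip u), (runL_flip w), Hp. f_equal. f_equal.
  destruct (Z_le_gt_dec (Z.abs i) s) as [|G]; auto.
  pose proof (lamp_off s u i 0 Hu ltac:(lia)). pose proof (lamp_off s w i 0 Hw ltac:(lia)).
  rewrite Z.add_0_l in *. congruence.
Qed.

Fixpoint sweep (f : Z -> bool) (lo : Z) (n : nat) : word :=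
  match n with
  | O => []
  | S m => (if f lo then [La] else []) ++ Lt :: sweep f (lo + 1) m
  end.

Lemma runL_La b i : runL [La] (b, i) = (if Z.eq_dec i 0 then negb b else b, i).
Proof. simpl. now destruct Z.eq_dec. Qed.

Lemma runL_sweep f lo n b z : runL (sweep f lo n) (b, (lo - z)%Z) =
  (xorb b (if Z_le_dec lo z then if Z_lt_dec z (lo + Z.of_nat n) then f z else false else false),
   (lo + Z.of_nat n - z)%Z).
Proof.
  revert lo b. induction n as [|n IH]; intros lo b.
  - simpl. f_equal; [|lia].
    destruct (Z_le_dec lo z), (Z_lt_dec z (lo + 0)); try lia; now destruct b.
  - cbn [sweep]. rewrite fold_left_app.
    assert (E : runL (if f lo then [La] else []) (b, (lo - z)%Z) =
      (if Z.eq_dec z lo then xorb b (f lo) else b, (lo - z)%Z)).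
    { destruct (f lo).
      - rewrite runL_La. f_equal. destruct (Z.eq_dec (lo - z) 0), (Z.eq_dec z lo); try lia; now destruct b.
      - simpl. f_equal. destruct (Z.eq_dec z lo); auto. now destruct b. }
    rewrite E. cbn [fold_left actL disp].
    replace (lo - z + 1)%Z with (lo + 1 - z)%Z by lia. rewrite IH. f_equal; [|lia].
    destruct (Z.eq_dec z lo) as [Hz|Hz]; [rewrite <- Hz in *|];
    repeat (destruct Z_le_dec || destruct Z_lt_dec); try lia;
    rewrite ?xorb_false_r; auto.
Qed.

Lemma sweep_length f lo n : (length (sweep f lo n) <= 2 * n)%nat.
Proof.
  revert lo. induction n as [|n IH]; intros lo; [simpl; lia|].
  cbn [sweep]. rewrite length_app. cbn [length]. specialize (IH (lo + 1)%Z).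
  destruct (f lo); simpl length; lia.
Qed.

Lemma runL_LT n b i : runL (repeat LT n) (b, i) = (b, (i - Z.of_nat n)%Z).
Proof.
  revert i. induction n as [|n IH]; intros i; [simpl; f_equal; lia|].
  change (runL (repeat LT n) (b, (i + -1)%Z) = (b, (i - Z.of_nat (S n))%Z)).
  rewrite IH. f_equal. lia.
Qed.

(** The cursor goes to [-r], sweeps to the right setting every lamp to its final state, and walks
    back to its final position. *)
Lemma normal_word r w : stay (Z.of_nat r) 0 w ->
  exists u, (length u <= 8 * r + 8)%nat /\ forall x, runL u x = runL w x.
Proof.
  intros Hst. pose proof (stay_end _ _ _ Hst) as He. rewrite Z.add_0_l in He.
  set (f := fun z => fst (runL w (false, - z)%Z)).
  set (R := Z.of_nat r) in *.
  exists (repeat LT r ++ sweep f (- R) (2 * r + 1) ++ repeat LT (Z.to_nat (R + 1 - pos w))).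
  split.
  - rewrite !length_app, !repeat_length. pose proof (sweep_length f (- R) (2 * r + 1)). lia.
  - intros [b i]. rewrite !fold_left_app, runL_LT.
    replace (i - Z.of_nat r)%Z with (- R - - i)%Z by lia.
    rewrite runL_sweep, runL_LT, (runL_flip w). f_equal; [|lia].
    f_equal. unfold f. rewrite Z.opp_involutive.
    destruct (Z_le_dec (- R) (- i)); [destruct Z_lt_dec; auto|];
    symmetry; rewrite <- (Z.add_0_l i); apply (lamp_off R); auto; lia.
Qed.

(** Graphs outside [ps] have crossing points so far apart that words of this total length satisfy
    there every relation of the lamplighter group. *)
Lemma weq_of_prefix p ps N u w :
  (forall j, In (p j) ps \/ (2 * N < fst (p j))%nat) ->
  (length u + length w <= N)%nat ->
  (forall x, runL u x = runL w x) ->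
  (forall pr, In pr ps -> forall x, runX pr u x = runX pr w x) ->
  weq p u w.
Proof.
  intros Hp HN HL HF. split; auto. intros j. destruct (Hp j) as [H|H]; auto.
  apply short_equal; auto. lia.
Qed.

(** The word is its lamplighter normal form times a kernel element, which is replaced by a short one
    with the same effect on the graphs in [ps]. The constant depends on [ps] alone, so later graphs
    may be chosen after it. *)
Lemma slow_norm ps : exists C, forall p n r,
  (forall j, In (p j) ps \/ (2 * (3 * n + 8 * r + 8 + C) < fst (p j))%nat) ->
  forall w, (length w <= 3 * n)%nat -> stay (Z.of_nat r) 0 w ->
  exists w', weq p w' w /\ (length w' <= 8 * r + 8 + C)%nat.
Proof.
  destruct (kernel_short ps) as [C HC]. exists C. intros p n r Hp w Hw Hst.
  destruct (normal_word r w Hst) as (u & Hu1 & Hu2).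
  destruct (HC (winv u ++ w)) as (v & Hv1 & Hv2 & Hv3).
  { intros x. rewrite fold_left_app, <- Hu2. apply run_Kwinv, actLK. }
  assert (Hl : (length (u ++ v) <= 8 * r + 8 + C)%nat) by (rewrite length_app; lia).
  exists (u ++ v). split; auto.
  eapply weq_of_prefix; [exact Hp|lia| |].
  - intros x. now rewrite fold_left_app, Hv2.
  - intros pr Hpr x. rewrite fold_left_app, Hv3, fold_left_app by auto.
    now rewrite (run_winvK (actX pr) (actXK pr)).
Qed.

(** At time [4^k] a window [2 k] times wider than the diffusive scale is left with probability at
    most [4 / 4^k], so on that event even the trivial length [3 n] contributes at most 12 to the
    mean. *)
Lemma slow_speed ps : exists C, forall k p, let n := (2 ^ k * 2 ^ k)%nat in
  let r := (2 ^ k * (2 * k))%nat in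
  (forall j, In (p j) ps \/ (2 * (3 * n + 8 * r + 8 + C) < fst (p j))%nat) ->
  exists L, (forall w, (length w <= 3 * n)%nat ->
      exists w', weq p w' w /\ INR (length w') <= L w) /\
    Ew n L [] <= 16 * INR k * 2 ^ k + 20 + INR C.
Proof.
  destruct (slow_norm ps) as [C HC]. exists C. intros k p n r Hp.
  exists (fun w => 1 * INR (8 * r + 8 + C) + INR (3 * n) * ind (~ stay (Z.of_nat r) 0 w)).
  split.
  - intros w Hw. destruct (classic (stay (Z.of_nat r) 0 w)) as [Hst|Hst].
    + destruct (HC p n r Hp w Hw Hst) as (w' & H1 & H2). exists w'. split; auto.
      rewrite ind_false by tauto. apply le_INR in H2. lra.
    + exists w. split; [apply weq_refl|]. rewrite ind_true by auto. apply le_INR in Hw.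
      pose proof (pos_INR (8 * r + 8 + C)). lra.
  - rewrite (Ew_lin n 1 (INR (3 * n)) (fun _ => INR (8 * r + 8 + C))), Ew_const.
    assert (E : Ew n (fun w => ind (~ stay (Z.of_nat r) 0 w)) [] <= 4 / 2 ^ (2 * k)).
    { apply Ew_exit_scaled. clear. induction k; simpl; lia. }
    assert (P2 : 0 < 2 ^ k) by (apply pow_lt; lra).
    assert (E2 : INR (3 * n) * (4 / 2 ^ (2 * k)) = 12).
    { unfold n. rewrite !mult_INR, pow_INR. simpl INR. replace (1 + 1) with 2 by lra.
      replace (2 * k)%nat with (k + k)%nat by lia. rewrite pow_add. field. lra. }
    assert (INR (3 * n) * Ew n (fun w => ind (~ stay (Z.of_nat r) 0 w)) [] <= 12).
    { rewrite <- E2. apply Rmult_le_compat_l; auto. apply pos_INR. }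
    assert (INR (8 * r + 8 + C) = 16 * INR k * 2 ^ k + 8 + INR C); [|lra].
    unfold r. rewrite !plus_INR, !mult_INR, pow_INR. simpl INR.
    replace (1 + 1) with 2 by lra. ring.
Qed.

(** The mean splits over the values of [phi], and the largest part is at least the average of the
    parts. *)
Lemma pigeon {V : Type} (phi : word -> V) (I : list V) n F : I <> [] ->
  (forall w, 0 <= F w) ->
  (forall w, (length w <= 3 * n)%nat -> F w <> 0 -> In (phi w) I) ->
  exists c, Ew n F [] <= INR (length I) * Ew n (fun w => F w * ind (phi w = c)) [].
Proof.
  intros HI HF H.
  assert (S1 : Ew n F [] <=
    fold_right Rplus 0 (map (fun c => Ew n (fun w => F w * ind (phi w = c)) []) I)).
  { apply Rle_trans with
      (Ew n (fun w => fold_right Rplus 0 (map (fun c => F w * ind (phi w = c)) I)) []).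
    - apply Ew_mono_len. intros w Hw. simpl length in Hw.
      assert (G : forall J, 0 <= fold_right Rplus 0 (map (fun c => F w * ind (phi w = c)) J)).
      { induction J as [|c J IH]; simpl; [lra|].
        pose proof (HF w). pose proof (ind_bounds (phi w = c)). nra. }
      destruct (Req_dec (F w) 0) as [E|E]; [rewrite E in *; auto|].
      specialize (H w ltac:(lia) E). clear - H HF G.
      induction I as [|c I IH]; [destruct H|]. simpl.
      pose proof (HF w). pose proof (ind_bounds (phi w = c)).
      destruct H as [->|H].
      + rewrite ind_true by auto. specialize (G I). lra.
      + specialize (IH H). nra.
    - clear. apply Req_le. induction I as [|c I IH]; simpl.
      + apply Ew_const.
      + rewrite <- IH.
        rewrite <- (Rmult_1_l (Ew n (fun w => F w * ind (phi w = c)) [])).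
        rewrite <- (Rmult_1_l (Ew n (fun w => fold_right Rplus 0 _) [])).
        rewrite <- Ew_lin. apply Ew_ext. intros; lra. }
  assert (S2 : forall J (g : V -> R), J <> [] ->
    exists c, fold_right Rplus 0 (map g J) <= INR (length J) * g c).
  { clear. intros J g. induction J as [|c J IH]; [tauto|]. intros _.
    destruct J as [|d J]; [exists c; simpl; lra|].
    destruct IH as [e He]; [discriminate|].
    assert (0 <= INR (length (d :: J))) by apply pos_INR.
    change (length (c :: d :: J)) with (S (length (d :: J))). rewrite S_INR.
    change (map g (c :: d :: J)) with (g c :: map g (d :: J)). cbn [fold_right].
    destruct (Rle_dec (g c) (g e)); [exists e|exists c]; nra. }
  destruct (S2 I (fun c => Ew n (fun w => F w * ind (phi w = c)) []) HI) as [c Hc].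
  exists c. simpl in Hc. lra.
Qed.

Definition window (s : nat) : list (bool * Z) :=
  map (fun k => (false, Z.of_nat k - Z.of_nat s)%Z) (seq 0 (2 * s + 1)).

Lemma in_window s i : (Z.abs i <= Z.of_nat s)%Z -> In (false, i) (window s).
Proof.
  intros H. apply in_map_iff. exists (Z.to_nat (i + Z.of_nat s)). split.
  - f_equal. lia.
  - apply in_seq. lia.
Qed.

(** If two independent walks stay in [[-s, s]] and agree on the window and on the tables for [ps],
    they are equal in the group, and following one by the inverse of the other returns to 1. By
    pigeonhole some common value is likely enough: [8 s + 2] images are possible for each of the
    [2 s + 1] window points, and [M] counts the tables. *)
Lemma slow_return ps : exists M, 1 <= M /\ forall p n s, (3 <= s)%nat ->
  (forall j, In (p j) ps \/ (12 * n < fst (p j))%nat) ->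
  ((1 - 9 / (2 * INR s ^ 2)) ^ n / (INR (8 * s + 2) ^ (2 * s + 1) * M)) ^ 2 <=
  Ew (n + n) (fun w => ind (weq p w [])) [].
Proof.
  destruct (finvals_finite ps) as [I HI].
  exists (INR (length I)). split.
  { apply (le_INR 1). specialize (HI []). destruct I; [destruct HI|simpl; lia]. }
  intros p n s Hs Hp.
  (* Starting offsets and displacements are both at most [s] in absolute value, so final offsets lie
     in [[-2 s, 2 s]]. *)
  set (Q := list_prod [true; false]
    (map (fun k => Z.of_nat k - 2 * Z.of_nat s)%Z (seq 0 (4 * s + 1)))).
  set (J := list_prod (tuples Q (length (window s))) I).
  set (phi := fun u => (map (runL u) (window s), finvals ps u)).
  set (F := fun w => ind (stay (Z.of_nat s) 0 w)).
  assert (HJ : forall w, stay (Z.of_nat s) 0 w -> In (phi w) J).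
  { intros w Hst. apply in_prod; auto.
    replace (length (window s)) with (length (map (runL w) (window s))) by apply length_map.
    apply in_tuples, Forall_forall.
    intros y Hy. apply in_map_iff in Hy. destruct Hy as (x & <- & Hx).
    unfold window in Hx. apply in_map_iff in Hx. destruct Hx as (k & <- & Hk).
    apply in_seq in Hk. rewrite runL_flip. apply in_prod.
    - simpl. destruct fst; auto.
    - pose proof (stay_end _ _ _ Hst). apply in_map_iff.
      exists (Z.to_nat (Z.of_nat k - Z.of_nat s + pos w + 2 * Z.of_nat s)).
      split; [lia|apply in_seq; lia]. }
  destruct (pigeon phi J n F) as [c Hc].
  - assert (H0 := HJ [] ltac:(simpl; lia)). destruct J; [destruct H0|discriminate].
  - intros; apply ind_bounds.
  - intros w _ Hw. apply HJ. unfold F in Hw.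
    destruct (classic (stay (Z.of_nat s) 0 w)); auto. rewrite ind_false in Hw; tauto.
  - set (q := Ew n (fun w => F w * ind (phi w = c)) []) in *.
    assert (LJ : INR (length J) = INR (8 * s + 2) ^ (2 * s + 1) * INR (length I)).
    { unfold J. rewrite length_prod, tuples_length, mult_INR, pow_INR.
      unfold Q. rewrite length_prod, length_map, length_seq.
      unfold window. rewrite length_map, length_seq. cbn [length].
      now replace (2 * (4 * s + 1))%nat with (8 * s + 2)%nat by lia. }
    rewrite <- LJ.
    pose proof (Ew_stay n s Hs) as St. change (Ew n _ []) with (Ew n F []) in St.
    assert (J0 : 0 < INR (length J)).
    { assert (H0 := HJ [] ltac:(simpl; lia)). destruct J; [destruct H0|].
      apply lt_0_INR. simpl; lia. }
    assert (HS : 3 <= INR s) by (apply (le_INR 3) in Hs; simpl in Hs; lra).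
    assert (R0 : 0 <= (1 - 9 / (2 * INR s ^ 2)) ^ n).
    { apply pow_le. assert (9 <= INR s ^ 2) by nra.
      assert (9 / (2 * INR s ^ 2) * (2 * INR s ^ 2) = 9) by (field; lra). nra. }
    apply Rle_trans with (q ^ 2).
    { apply pow_incr. split.
      - apply Rmult_le_pos; auto. now apply Rlt_le, Rinv_0_lt_compat.
      - apply Rmult_le_reg_r with (INR (length J)); auto.
        unfold Rdiv. rewrite Rmult_assoc, Rinv_l by lra. lra. }
    rewrite Ew_add.
    set (g := fun w => F w * ind (phi w = c)) in *.
    assert (Hg : forall w, 0 <= g w).
    { intros w. apply Rmult_le_pos; apply ind_bounds. }
    apply Rle_trans with (Ew n (fun w => q * g w) []).
    { rewrite Ew_scal. fold q. apply Req_le. ring. }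
    apply Ew_mono_len. intros w Hw. simpl length in Hw.
    (* The second half of the walk is inverted, which makes it an independent copy of the first
       half. *)
    rewrite Ew_shift, <- (Ew_winv n (fun u => ind (weq p (w ++ u) []))).
    rewrite Rmult_comm. unfold q. rewrite <- Ew_scal.
    apply Ew_mono_len. intros u Hu. simpl length in Hu.
    pose proof (ind_bounds (weq p (w ++ winv u) [])).
    unfold g, F.
    destruct (classic (stay (Z.of_nat s) 0 w)) as [Sw|Sw]; [|rewrite (ind_false _ Sw); lra].
    destruct (classic (stay (Z.of_nat s) 0 u)) as [Su|Su]; [|rewrite (ind_false _ Su); lra].
    destruct (classic (phi w = c)) as [Ew1|Ew1]; [|rewrite (ind_false _ Ew1); lra].
    destruct (classic (phi u = c)) as [Eu|Eu]; [|rewrite (ind_false _ Eu); lra].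
    rewrite !ind_true; auto; [lra|].
    apply weq_trans with (u ++ winv u).
    2:{ rewrite <- (winvK u) at 1. apply weq_winv_l. }
    apply weq_app; [|apply weq_refl].
    assert (Eq : phi w = phi u) by congruence.
    assert (Eq1 : map (runL w) (window s) = map (runL u) (window s)) by exact (f_equal fst Eq).
    assert (Eq2 : finvals ps w = finvals ps u) by exact (f_equal snd Eq).
    assert (Hx : forall i, (Z.abs i <= Z.of_nat s)%Z -> runL w (false, i) = runL u (false, i)).
    { intros i Hi. apply (proj1 map_ext_in_iff Eq1). now apply in_window. }
    eapply (weq_of_prefix p ps (6 * n)).
    + intros j. destruct (Hp j); auto. right. lia.
    + lia.
    + apply (lamps_determine (Z.of_nat s)); auto.
      * specialize (Hx 0%Z ltac:(lia)). apply (f_equal snd) in Hx.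
        rewrite !runL_pos in Hx. lia.
      * intros i Hi. now rewrite Hx.
    + now apply finvals_eq.
Qed.

(** * Choice of the parameters *)

Lemma log_below_power A B e : 0 <= A -> 0 <= B -> 0 < e ->
  exists X, 1 <= X /\ forall x, X <= x -> A + B * ln x <= Rpower x e.
Proof.
  intros HA HB He. set (Y := 1 + 4 * (A + B) / e ^ 2).
  assert (He2 : 0 < e ^ 2) by (apply pow_lt; auto).
  assert (HY0 : 0 <= 4 * (A + B) / e ^ 2).
  { apply Rmult_le_pos; [lra|]. apply Rlt_le, Rinv_0_lt_compat; auto. }
  exists (exp Y). split.
  { pose proof (exp_ineq1_le Y). unfold Y in *. lra. }
  intros x Hx. assert (Hx0 : 0 < x) by (pose proof (exp_pos Y); lra).
  assert (Hy : Y <= ln x).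
  { rewrite <- (ln_exp Y). destruct Hx as [Hx|<-]; [|lra].
    apply Rlt_le, ln_increasing; auto. apply exp_pos. }
  unfold Rpower. set (y := ln x) in *.
  replace (e * y) with (e * y / 2 + e * y / 2) by lra. rewrite exp_plus.
  assert (Hy1 : 1 <= y) by (unfold Y in *; lra).
  pose proof (exp_ineq1_le (e * y / 2)) as E.
  assert (H0 : 0 <= e * y) by (apply Rmult_le_pos; lra).
  assert (e * y / 2 * (e * y / 2) <= exp (e * y / 2) * exp (e * y / 2))
    by (apply Rmult_le_compat; lra).
  assert (4 * (A + B) <= e ^ 2 * y).
  { replace (4 * (A + B)) with (e ^ 2 * (4 * (A + B) / e ^ 2)) by (field; lra).
    apply Rmult_le_compat_l; [lra|]. unfold Y in *. lra. }
  assert (4 * (A + B) * y <= e ^ 2 * y * y) by (apply Rmult_le_compat_r; lra).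
  nra.
Qed.

Lemma exists_INR_ge X : exists n, X <= INR n.
Proof.
  destruct (INR_unbounded X) as [n Hn]. exists n. lra.
Qed.

Lemma one_minus_ge_exp x : 0 <= x <= 1/2 -> exp (- (2 * x)) <= 1 - x.
Proof.
  intros Hx. rewrite exp_Ropp. pose proof (exp_ineq1_le (2 * x)).
  apply Rmult_le_reg_l with (exp (2 * x)); [apply exp_pos|].
  rewrite Rinv_r by (pose proof (exp_pos (2 * x)); lra). nra.
Qed.

Lemma exp_pow x n : exp x ^ n = exp (INR n * x).
Proof. rewrite <- Rpower_pow by apply exp_pos. unfold Rpower. now rewrite ln_exp. Qed.

Lemma pow_exp_ln x n : 0 < x -> x ^ n = exp (INR n * ln x).
Proof. intros H. rewrite <- exp_pow, exp_ln; auto. Qed.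

Lemma exp_le x y : x <= y -> exp x <= exp y.
Proof. intros [H|<-]; [now apply Rlt_le, exp_increasing|lra]. Qed.

Lemma ln_le_sub1 x : 0 < x -> ln x <= x - 1.
Proof.
  intros H. pose proof (exp_ineq1_le (ln x)). rewrite exp_ln in H0; auto. lra.
Qed.

(** With half-time [s^3], confinement to [[-s, s]] costs [exp (-9 s)] and the number of
    configurations a factor [exp (O(s ln s))]; the logarithm is absorbed by the extra exponent
    [e]. *)
Lemma slow_return_asymp M e N : 1 <= M -> 0 < e ->
  exists s, (N <= s)%nat /\ (3 <= s)%nat /\
    exp (- Rpower (INR (s ^ 3 + s ^ 3)) (1/3 + e)) <=
    ((1 - 9 / (2 * INR s ^ 2)) ^ (s ^ 3) / (INR (8 * s + 2) ^ (2 * s + 1) * M)) ^ 2.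
Proof.
  intros HM He.
  assert (HlM : 0 <= ln M).
  { rewrite <- ln_1. destruct HM as [HM|<-]; [|lra]. apply Rlt_le, ln_increasing; lra. }
  (* Twice [9 s + (2 s + 1) ln (8 s + 2) + ln M] is at most [s (72 + 2 ln M + 6 ln s)]. *)
  destruct (log_below_power (72 + 2 * ln M) 6 (3 * e)) as (X & HX1 & HX); try lra.
  destruct (exists_INR_ge X) as [k Hk].
  set (s := (k + N + 3)%nat). exists s. split; [lia|]. split; [lia|].
  assert (Hs : X <= INR s) by (unfold s; rewrite !plus_INR; pose proof (pos_INR N); simpl; lra).
  assert (Hs3 : 3 <= INR s).
  { replace 3 with (INR 3) by (simpl; lra). apply le_INR. lia. }
  specialize (HX _ Hs). clearbody s.
  assert (El : INR (8 * s + 2) = 8 * INR s + 2).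
  { rewrite plus_INR, mult_INR. simpl. lra. }
  assert (Em : INR (2 * s + 1) = 2 * INR s + 1).
  { rewrite plus_INR, mult_INR. simpl. lra. }
  assert (En : INR (s ^ 3) = INR s ^ 3) by apply pow_INR.
  assert (E1 : exp (- (9 * INR s)) <= (1 - 9 / (2 * INR s ^ 2)) ^ (s ^ 3)).
  { replace (exp (- (9 * INR s))) with (exp (- (2 * (9 / (2 * INR s ^ 2)))) ^ (s ^ 3)).
    - apply pow_incr. split; [apply Rlt_le, exp_pos|]. apply one_minus_ge_exp.
      assert (9 <= INR s ^ 2) by nra.
      assert (9 / (2 * INR s ^ 2) * (2 * INR s ^ 2) = 9) by (field; lra).
      split; nra.
    - rewrite exp_pow, En. f_equal. field. lra. }
  rewrite El. rewrite (pow_exp_ln (8 * INR s + 2)) by lra. rewrite Em.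
  rewrite <- (exp_ln M) by lra. rewrite <- exp_plus.
  set (Z := (2 * INR s + 1) * ln (8 * INR s + 2) + ln M).
  apply Rle_trans with ((exp (- (9 * INR s)) / exp Z) ^ 2).
  2:{ pose proof (exp_pos (- (9 * INR s))).
      assert (0 < / exp Z) by apply Rinv_0_lt_compat, exp_pos.
      apply pow_incr. split; [apply Rmult_le_pos; lra|].
      apply Rmult_le_compat_r; lra. }
  unfold Rdiv. rewrite <- exp_Ropp, <- exp_plus, exp_pow. apply exp_le.
  change (INR 2) with (1 + 1).
  assert (L : ln (8 * INR s + 2) <= 9 + ln (INR s)).
  { apply Rle_trans with (ln (10 * INR s)).
    - destruct (Req_dec (8 * INR s + 2) (10 * INR s)) as [->|]; [lra|].
      apply Rlt_le, ln_increasing; lra.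
    - rewrite ln_mult by lra. pose proof (ln_le_sub1 10). lra. }
  assert (L0 : 0 <= ln (INR s)).
  { rewrite <- ln_1. apply Rlt_le, ln_increasing; lra. }
  assert (HZ : Z <= INR s * (27 + 3 * ln (INR s) + ln M)).
  { unfold Z. apply Rle_trans with (3 * INR s * (9 + ln (INR s)) + INR s * ln M); [|lra].
    apply Rplus_le_compat; [|nra].
    apply Rle_trans with ((2 * INR s + 1) * (9 + ln (INR s))).
    - apply Rmult_le_compat_l; lra.
    - apply Rmult_le_compat_r; lra. }
  assert (HR : INR s * Rpower (INR s) (3 * e) <= Rpower (INR (s ^ 3 + s ^ 3)) (1/3 + e)).
  { rewrite <- (Rpower_1 (INR s)) at 1 by lra. rewrite <- Rpower_plus.
    replace (1 + 3 * e) with (INR 3 * (1/3 + e)) by (simpl; lra).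
    rewrite <- Rpower_mult, Rpower_pow by lra.
    apply Rle_Rpower_l; [lra|]. rewrite plus_INR, En.
    assert (0 < INR s ^ 3) by (apply pow_lt; lra). lra. }
  assert (INR s * (72 + 2 * ln M + 6 * ln (INR s)) <= INR s * Rpower (INR s) (3 * e)).
  { apply Rmult_le_compat_l; lra. }
  lra.
Qed.

Lemma ln_4_bounds : 1 <= ln 4 <= 2.
Proof.
  pose proof exp_le_3. split.
  - rewrite <- (ln_exp 1). apply Rlt_le, ln_increasing; [apply exp_pos|lra].
  - rewrite <- (ln_exp 2). apply Rlt_le, ln_increasing; [lra|].
    replace 2 with (1 + 1) by lra. rewrite exp_plus.
    assert (2 < exp 1) by (pose proof (exp_ineq1 1); lra). nra.
Qed.

Lemma INR_4k k : INR (2 ^ k * 2 ^ k) = 4 ^ k.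
Proof.
  rewrite mult_INR, pow_INR. simpl INR. replace (1 + 1) with 2 by lra.
  rewrite <- Rpow_mult_distr. f_equal; lra.
Qed.

(** The factor [2^k] is the square root of the time [4^k], and [k] is logarithmic in that time. *)
Lemma slow_speed_asymp C e N : 0 < e ->
  exists k, (N <= k)%nat /\
    16 * INR k * 2 ^ k + 20 + INR C <= Rpower (INR (2 ^ k * 2 ^ k)) (1/2 + e).
Proof.
  intros He. pose proof ln_4_bounds as L4. pose proof (pos_INR C) as HC.
  destruct (log_below_power (20 + INR C) 16 e) as (X & HX1 & HX); try lra.
  destruct (exists_INR_ge X) as [j Hj].
  set (k := (N + j)%nat). exists k. split; [lia|].
  assert (Hk : INR k <= 4 ^ k).
  { clear. induction k as [|k IH]; [simpl; lra|]. rewrite S_INR. simpl.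
    assert (1 <= 4 ^ k) by (apply pow_R1_Rle; lra). lra. }
  assert (HXk : X <= 4 ^ k).
  { apply Rle_trans with (INR k); auto. unfold k. rewrite plus_INR.
    pose proof (pos_INR N). lra. }
  specialize (HX _ HXk). rewrite INR_4k.
  assert (H4 : 0 < 4 ^ k) by (apply pow_lt; lra).
  assert (H2 : 1 <= 2 ^ k) by (apply pow_R1_Rle; lra).
  rewrite Rpower_plus.
  replace (Rpower (4 ^ k) (1/2)) with (2 ^ k).
  2:{ replace (4 ^ k) with ((2 ^ k) ^ 2).
      - rewrite <- (Rpower_pow 2 (2 ^ k)) by lra. rewrite Rpower_mult.
        replace (INR 2 * (1/2)) with 1 by (simpl; lra). rewrite Rpower_1; lra.
      - rewrite <- pow_mult, Nat.mul_comm, pow_mult. f_equal. lra. }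
  assert (E : ln (4 ^ k) = INR k * ln 4).
  { rewrite pow_exp_ln by lra. apply ln_exp. }
  rewrite E in HX. pose proof (pos_INR k).
  assert (2 ^ k * (20 + INR C + 16 * INR k) <= 2 ^ k * Rpower (4 ^ k) e).
  { apply Rmult_le_compat_l; [lra|]. nra. }
  nra.
Qed.

Definition retp (p : nat -> nat * nat) (n : nat) : R :=
  Ew n (fun w => ind (weq p w [])) [].

(** The exponents 1/3 and 1/2 are attained up to [1 / (m + 1)] at times past [m]. The length is
    bounded through words equal to [w], which serves every word norm at once. *)
Definition slow_at (p : nat -> nat * nat) (m : nat) : Prop :=
  (exists n, (m <= n)%nat /\
    exp (- Rpower (INR n) (1/3 + / INR (S m))) <= retp p n) /\
  (exists n L, (m <= n)%nat /\
    (forall w, (length w <= 3 * n)%nat ->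
       exists w', weq p w' w /\ INR (length w') <= L w) /\
    Ew n L [] <= Rpower (INR n) (1/2 + / INR (S m))).

(** Fixing the earlier graphs fixes the constants, hence the two times, hence how large [R] must be
    for the other graphs to be invisible at those times. *)
Lemma slow_stage m ps : exists r, forall p,
  (forall j, In (p j) ps \/ (r < fst (p j))%nat) -> slow_at p m.
Proof.
  destruct (slow_return ps) as (M & HM & HRet).
  destruct (slow_speed ps) as (C & HSp).
  assert (He : 0 < / INR (S m)) by (apply Rinv_0_lt_compat, lt_0_INR; lia).
  destruct (slow_return_asymp M (/ INR (S m)) m HM He) as (s & Hs1 & Hs2 & Hs3).
  destruct (slow_speed_asymp C (/ INR (S m)) m He) as (k & Hk1 & Hk2).
  set (n := (2 ^ k * 2 ^ k)%nat) in *. set (r := (2 ^ k * (2 * k))%nat).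
  exists (12 * s ^ 3 + 2 * (3 * n + 8 * r + 8 + C))%nat. intros p Hp. split.
  - exists (s ^ 3 + s ^ 3)%nat. split.
    + assert (s <= s ^ 3)%nat; [|lia]. simpl. nia.
    + apply Rle_trans with (1 := Hs3). apply HRet; auto.
      intros j. destruct (Hp j); [auto|right; lia].
  - destruct (HSp k p) as (L & HL1 & HL2).
    { intros j. destruct (Hp j); [auto|right]. fold n r. lia. }
    exists n, L. split; [|split; [exact HL1|exact (Rle_trans _ _ _ HL2 Hk2)]].
    apply Nat.le_trans with k; auto.
    assert (k <= 2 ^ k)%nat by (apply Nat.lt_le_incl, Nat.pow_gt_lin_r; lia).
    unfold n. nia.
Qed.

(** A function of the group element that decays at most exponentially in word length but has tiny
    mean at time [n] bounds both the return probability and the displacement. Even [n] makes a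
    return possible. *)
Definition fast_at (p : nat -> nat * nat) (m : nat) : Prop :=
  exists n F, (m <= n)%nat /\ Nat.Even n /\
    2 <= Rpower (INR n) (1 - / INR (S m)) /\
    (forall u w, weq p u w -> F u = F w) /\
    (forall w, (1/4) ^ length w <= F w) /\
    Ew n F [] <= exp (- Rpower (INR n) (1 - / INR (S m))).

(** With [K = 200 R^2] the height contracts by [1 - 1/K] per step, so at time [n = K^(m+1)] its mean
    is at most [exp (-K^m)], and [K^m = n^(1 - 1/(m+1))]. *)
Lemma fast_stage p j m : let n := ((200 * fst (p j) ^ 2) ^ S m)%nat in
  (1 <= m)%nat -> (2 <= fst (p j))%nat -> (3 * n < snd (p j))%nat -> fast_at p m.
Proof.
  intros n Hm HR HD. set (K := (200 * fst (p j) ^ 2)%nat) in *.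
  assert (HK : (800 <= K)%nat) by (unfold K; simpl; nia).
  assert (HKR : 800 <= INR K).
  { apply le_INR in HK. replace (INR 800) with 800 in HK; auto. now rewrite INR_IZR_INZ. }
  assert (EK : INR K = 200 * INR (fst (p j)) ^ 2).
  { unfold K. rewrite mult_INR, pow_INR. f_equal. now rewrite INR_IZR_INZ. }
  assert (ER : Rpower (INR n) (1 - / INR (S m)) = INR K ^ m).
  { unfold n. rewrite pow_INR, <- !Rpower_pow by lra. rewrite Rpower_mult. f_equal.
    rewrite S_INR. field. pose proof (pos_INR m). lra. }
  exists n, (fun w => height (INR (fst (p j))) (runX (p j) w root)). rewrite ER.
  split; [|split; [|split; [|split; [|split]]]].
  - apply Nat.le_trans with (S m); [lia|]. apply Nat.lt_le_incl, Nat.pow_gt_lin_r. lia.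
  - unfold n. rewrite Nat.pow_succ_r by lia. unfold K at 1.
    exists (100 * fst (p j) ^ 2 * K ^ m)%nat. ring.
  - apply Rle_trans with (INR K ^ 1); [lra|]. apply Rle_pow; [lra|auto].
  - intros u w [_ H]. now rewrite H.
  - intros w. now apply height_run.
  - eapply Rle_trans; [apply Ew_height; auto|]. rewrite <- EK.
    apply Rle_trans with (exp (- / INR K) ^ n).
    + assert (/ INR K <= 1).
      { rewrite <- Rinv_1. apply Rinv_le_contravar; lra. }
      apply pow_incr. pose proof (exp_ineq1_le (- / INR K)). lra.
    + rewrite exp_pow. unfold n. rewrite pow_INR. apply exp_le.
      simpl. right. field. lra.
Qed.

Lemma good_parameters : exists p, forall m, (1 <= m)%nat -> slow_at p m /\ fast_at p m.
Proof.
  set (r := fun m ps => proj1_sig (constructive_indefinite_description _ (slow_stage m ps))).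
  assert (Hr : forall m ps p, (forall j, In (p j) ps \/ (r m ps < fst (p j))%nat) -> slow_at p m).
  { intros m ps. unfold r. now destruct constructive_indefinite_description. }
  clearbody r.
  (* Adding the sum of the earlier values of [R] makes [R] nondecreasing, so later graphs clear
     earlier thresholds too. The 2 is the least [R] for which the height function works, and [D]
     exceeds three times the fast time. *)
  set (next := fun m ps => let R := (r m ps + list_sum (map fst ps) + 2)%nat in
    (R, 3 * (200 * R ^ 2) ^ S m + 1)%nat).
  set (pre := fix pre m := match m with O => [] | S m' => next m' (pre m') :: pre m' end).
  set (p := fun m => next m (pre m)).
  exists p. intros m Hm.
  assert (In_pre : forall i j, (i < j)%nat -> In (p i) (pre j)).
  { intros i j H. induction H as [|j H IH]; simpl; auto. }
  assert (Sum : forall (x : nat * nat) ps, In x ps -> (fst x <= list_sum (map fst ps))%nat).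
  { intros x ps. induction ps as [|y ps IH]; simpl; [tauto|].
    intros [->|H]; [lia|apply IH in H; lia]. }
  split.
  - apply (Hr m (pre m)). intros j. destruct (le_lt_dec m j) as [H|H]; [right|auto].
    assert (Hm' : (r m (pre m) < fst (p m))%nat) by (unfold p, next; simpl; lia).
    destruct (Nat.eq_dec m j) as [<-|]; auto.
    assert (H1 := Sum _ _ (In_pre m j ltac:(lia))).
    assert (list_sum (map fst (pre j)) <= fst (p j))%nat by (unfold p, next; simpl; lia).
    lia.
  - apply (fast_stage p m m); auto.
    + unfold p, next. cbn [fst]. lia.
    + unfold p, next. cbn [fst snd]. lia.
Qed.

(** * Return probability *)

Lemma return_prob_retp p n : return_prob (Delta p) (mu p) (supp p) n = retp p n.
Proof.
  unfold return_prob, retp. rewrite (walk_sum_Ew p n _ []). apply Ew_ext. intros u.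
  destruct (geq_dec (Delta p) (mk p u) (gone (Delta p))) as [H|H].
  - rewrite ind_true; auto. now apply mk_eq.
  - rewrite ind_false; auto. intros H'. apply H. now apply mk_eq.
Qed.

Lemma cube_floor n : exists s, (s ^ 3 <= n < (s + 1) ^ 3)%nat.
Proof.
  induction n as [|n [s Hs]]; [exists 0%nat; simpl; lia|].
  destruct (Nat.eq_dec (S n) ((s + 1) ^ 3)) as [E|E].
  - exists (s + 1)%nat. rewrite E. split; auto. apply Nat.pow_lt_mono_l; lia.
  - exists s. lia.
Qed.

(** At a return all lamps are off. With [s] the integer cube root of [n], both [2^(-s)] and
    [exp (-n / (3 s^2))] are at most [exp (-s / 3)]. *)
Lemma retp_upper p n : (1000 <= n)%nat -> retp p n <= exp (- (Rpower (INR n) (1/3) / 12)).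
Proof.
  intros Hn. destruct (cube_floor n) as [s [H1 H2]].
  assert (Hs : (9 <= s)%nat).
  { destruct (le_lt_dec 9 s) as [H|H]; auto. exfalso.
    assert ((s + 1) ^ 3 <= 9 ^ 3)%nat by (apply Nat.pow_le_mono_l; lia).
    change (9 ^ 3)%nat with 729%nat in *. lia. }
  assert (HS : 9 <= INR s).
  { apply le_INR in Hs. replace (INR 9) with 9 in Hs; auto. now rewrite INR_IZR_INZ. }
  assert (HA : Rpower (INR n) (1/3) <= INR s + 1).
  { apply lt_INR in H2. rewrite pow_INR, plus_INR in H2. change (INR 1) with 1 in H2.
    replace (INR s + 1) with (Rpower ((INR s + 1) ^ 3) (1/3)).
    - apply Rle_Rpower_l; [lra|]. split; [apply lt_0_INR; lia|lra].
    - rewrite <- (Rpower_pow 3) by lra. rewrite Rpower_mult.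
      replace (INR 3 * (1/3)) with 1 by (simpl; lra). apply Rpower_1; lra. }
  assert (HB : INR s ^ 3 <= INR n) by (rewrite <- pow_INR; now apply le_INR).
  destruct (lampsoff_bound n s ltac:(lia)) as [zs Hzs].
  assert (B1 : retp p n <= Ew n (lampsoff zs) []).
  { apply Ew_mono. intros u. destruct (classic (weq p u [])) as [H|H].
    - rewrite ind_true, lampsoff_trivial; auto; [lra|]. intros x. apply (proj1 H).
    - rewrite ind_false; auto. apply lampsoff_nonneg. }
  assert (B2 : / 2 ^ s <= exp (- (INR s / 3))).
  { rewrite <- (Rinv_r_simpl_m 1 (exp (- (INR s / 3)))) by lra.
    rewrite exp_Ropp. rewrite Rmult_1_l, Rinv_1, Rmult_1_r.
    apply Rinv_le_contravar; [apply exp_pos|].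
    replace (exp (INR s / 3)) with (exp (1/3) ^ s) by (rewrite exp_pow; f_equal; lra).
    apply pow_incr. split; [apply Rlt_le, exp_pos|].
    pose proof exp_le_3 as E3. replace 1 with (1/3 + 1/3 + 1/3) in E3 by lra.
    rewrite !exp_plus in E3. pose proof (exp_pos (1/3)).
    destruct (Rle_dec (exp (1/3)) 2); auto. exfalso. nra. }
  assert (B3 : (1 - 1 / (3 * INR s ^ 2)) ^ n <= exp (- (INR s / 3))).
  { assert (HS2 : 0 < INR s ^ 2) by nra.
    apply Rle_trans with (exp (- (1 / (3 * INR s ^ 2))) ^ n).
    - apply pow_incr. split.
      + assert (1 / (3 * INR s ^ 2) * (3 * INR s ^ 2) = 1) by (field; lra). nra.
      + pose proof (exp_ineq1_le (- (1 / (3 * INR s ^ 2)))). lra.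
    - rewrite exp_pow. apply exp_le.
      assert (INR s / 3 <= INR n * (1 / (3 * INR s ^ 2))); [|lra].
      replace (INR s / 3) with (INR s ^ 3 * (1 / (3 * INR s ^ 2))) by (field; lra).
      apply Rmult_le_compat_r; auto. apply Rlt_le, Rdiv_lt_0_compat; lra. }
  assert (B4 : 4 <= exp 2).
  { replace 2 with (1 + 1) by lra. rewrite exp_plus.
    assert (2 < exp 1) by (pose proof (exp_ineq1 1); lra). nra. }
  (* The prefactor 7/2 is below [exp 2], and [s / 3 - 2 >= (s + 1) / 12] because [s >= 9]. *)
  apply Rle_trans with (exp 2 * exp (- (INR s / 3))).
  - pose proof (exp_pos (- (INR s / 3))). unfold Rdiv at 1 in Hzs. nra.
  - rewrite <- exp_plus. apply exp_le. lra.
Qed.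

(** Alternating the steps [t] and [t^(-1)] gives a loop of every even length. *)
Lemma retp_even_pos p n : Nat.Even n -> 0 < retp p n.
Proof.
  intros [k ->].
  assert (G : forall k w, weq p w [] -> 0 < Ew (2 * k) (fun u => ind (weq p u [])) w).
  { clear k. induction k as [|k IH]; intros w Hw; [simpl; rewrite ind_true; auto; lra|].
    replace (2 * S k)%nat with (2 + 2 * k)%nat by lia. cbn [Nat.add Ew].
    set (F := Ew (2 * k) (fun u => ind (weq p u []))) in *.
    assert (HF : forall u, 0 <= F u) by (intros; apply Ew_nonneg; intros; apply ind_bounds).
    assert (H1 : 0 < F (w ++ [Lt] ++ winv [Lt])).
    { apply IH. apply (weq_trans p _ ([] ++ [])); [|apply weq_refl].
      apply weq_app; auto. rewrite <- (winvK [Lt]) at 1. apply weq_winv_l. }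
    assert (A : forall F' u t, (forall v, 0 <= F' v) -> In t steps -> F' (u ++ t) / 8 <= avg F' u).
    { clear. intros F' u t HF Ht. unfold avg. apply Rmult_le_compat_r; [lra|].
      induction steps as [|t' l IH]; [destruct Ht|]. simpl.
      assert (0 <= fold_right Rplus 0 (map (fun s => F' (u ++ s)) l)).
      { clear - HF. induction l; simpl; [lra|]. pose proof (HF (u ++ a)). lra. }
      pose proof (HF (u ++ t')). destruct Ht as [->|Ht]; [lra|]. specialize (IH Ht). lra. }
    assert (HF2 : forall u, 0 <= avg F u).
    { intros u. change (avg F u) with (Ew 1 F u). now apply Ew_nonneg. }
    pose proof (A (avg F) w [Lt] HF2 ltac:(simpl; auto)) as A1.
    pose proof (A F (w ++ [Lt]) [LT] HF ltac:(simpl; tauto)) as A2.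
    rewrite <- app_assoc in A2. change (winv [Lt]) with [LT] in H1. change (0 < avg (avg F) w). lra. }
  apply G, weq_refl.
Qed.

(** A positive probability comes from at least one sequence of [n] steps, and each sequence has
    weight [(1/8)^n]. *)
Lemma retp_lower p n : 0 < retp p n -> (1/8) ^ n <= retp p n.
Proof.
  unfold retp. generalize (@nil letter) at 2 4.
  induction n as [|n IH]; intros w H; simpl in *.
  - unfold ind in *. destruct excluded_middle_informative; lra.
  - set (F := Ew n (fun u => ind (weq p u []))) in *.
    assert (HF : forall u, 0 <= F u) by (intros; apply Ew_nonneg; intros; apply ind_bounds).
    assert (HP : 0 < (1/8) ^ n) by (apply pow_lt; lra).
    unfold avg in *. revert H.
    set (S := fun l => fold_right Rplus 0 (map (fun s => F (w ++ s)) l)).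
    change (0 < S steps / 8 -> 1/8 * (1/8) ^ n <= S steps / 8). intros H.
    assert (G : forall l, 0 <= S l /\ (0 < S l -> (1/8) ^ n <= S l)).
    { induction l as [|t l [G1 G2]]; unfold S in *; simpl; [split; lra|].
      pose proof (HF (w ++ t)) as HFt. split; [lra|]. intros HS.
      destruct (Req_dec (F (w ++ t)) 0) as [E|E].
      - assert (0 < fold_right Rplus 0 (map (fun s => F (w ++ s)) l)) by lra.
        specialize (G2 H0). lra.
      - assert (0 < F (w ++ t)) by lra. apply IH in H0. fold F in H0. lra. }
    destruct (G steps) as [_ G2]. specialize (G2 ltac:(lra)). lra.
Qed.

(** * Word norms *)

Section Norm.
Variables (p : nat -> nat * nat) (T : list (Delta p)) (nrm : Delta p -> nat).
Hypothesis Hnrm : is_word_norm (Delta p) T nrm.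

Lemma gprod_app (v w : list (Delta p)) :
  gprod (Delta p) (v ++ w) = gmul (Delta p) (gprod (Delta p) v) (gprod (Delta p) w).
Proof.
  induction v as [|x v IH]; simpl.
  - symmetry. apply (gmul_1l (Delta p)).
  - unfold gprod in *. simpl in *. rewrite IH. apply (gmul_assoc (Delta p)).
Qed.

(** Each letter of [T] or its inverse is spelled by a fixed word in [t] and [a]; the longest
    spelling bounds the distortion. *)
Lemma norm_lower : exists K, (1 <= K)%nat /\ forall w,
  exists u, weq p u w /\ (length u <= K * nrm (mk p w))%nat.
Proof.
  exists (S (list_sum (map (fun t => length (repr p t)) T))). split; [lia|].
  set (K := S _).
  assert (HK : forall t, In t T -> (length (repr p t) <= K)%nat).
  { intros t Ht. unfold K. clear K Hnrm. induction T as [|t' l IH]; [destruct Ht|].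
    simpl. destruct Ht as [->|Ht]; [lia|]. specialize (IH Ht). lia. }
  assert (HL : forall s, letter_of (Delta p) T s -> exists v, mk p v = s /\ (length v <= K)%nat).
  { intros s [Hs|Hs].
    - exists (repr p s). split; [apply mk_repr|auto].
    - exists (winv (repr p (ginv (Delta p) s))). split; [|rewrite winv_length; auto].
      rewrite <- mk_winv, mk_repr. simpl.
      rewrite <- (mk_repr p s), !mk_winv. now rewrite winvK. }
  intros w. destruct (proj1 (Hnrm (mk p w))) as (ts & H1 & H2 & H3).
  rewrite <- H3. clear H3.
  assert (G : exists u, mk p u = gprod (Delta p) ts /\ (length u <= K * length ts)%nat).
  { clear H2. induction H1 as [|s ts Hs _ (u & Hu1 & Hu2)]; [exists []; simpl; auto with arith|].
    destruct (HL s Hs) as (v & Hv1 & Hv2). exists (v ++ u). split.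
    - rewrite <- mk_app, Hu1, Hv1. reflexivity.
    - rewrite length_app. cbn [length]. rewrite Nat.mul_succ_r. lia. }
  destruct G as (u & Hu1 & Hu2). exists u. split; auto.
  apply mk_eq. now rewrite Hu1.
Qed.

Lemma norm_upper : exists C, (1 <= C)%nat /\ forall u w,
  weq p u w -> (nrm (mk p w) <= C * length u)%nat.
Proof.
  exists (S (nrm (mk p [Lt]) + nrm (mk p [LT]) + nrm (mk p [La]))). split; [lia|].
  set (C := S _). intros u w H. apply mk_eq in H. rewrite <- H. clear w H.
  assert (G : exists ts, Forall (letter_of (Delta p) T) ts /\
    gprod (Delta p) ts = mk p u /\ (length ts <= C * length u)%nat).
  { induction u as [|l u (ts & H1 & H2 & H3)].
    - exists []. repeat split; auto. simpl. lia.
    - destruct (proj1 (Hnrm (mk p [l]))) as (tl & L1 & L2 & L3).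
      exists (tl ++ ts). split; [now apply Forall_app|]. split.
      + rewrite gprod_app, L2, H2. apply (mk_app p [l] u).
      + rewrite length_app, L3. cbn [length]. rewrite Nat.mul_succ_r.
        assert (nrm (mk p [l]) <= C)%nat by (unfold C; destruct l; lia). lia. }
  destruct G as (ts & H1 & H2 & H3).
  pose proof (proj2 (Hnrm (mk p u)) ts H1 H2). lia.
Qed.

Notation E n := (expected_norm (Delta p) (mu p) (supp p) nrm n).

Lemma expected_norm_Ew n : E n = Ew n (fun u => INR (nrm (mk p u))) [].
Proof. apply (walk_sum_Ew p n (fun g => INR (nrm g)) []). Qed.

(** The cursor position depends only on the group element and is at most the length of any word for
    it. *)
Lemma expected_norm_diffusive : exists c, 0 < c /\
  forall n, (1 <= n)%nat -> c * sqrt (INR n) <= E n.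
Proof.
  destruct norm_lower as (K & HK1 & HK). apply le_INR in HK1. simpl in HK1.
  exists (/ (4 * INR K)). split; [apply Rinv_0_lt_compat; lra|]. intros n Hn.
  rewrite expected_norm_Ew. pose proof (Ew_abs_pos n Hn) as H.
  apply Rle_trans with (/ INR K * Ew n (fun u => Rabs (IZR (pos u))) []).
  { rewrite Rinv_mult. assert (0 < / INR K) by (apply Rinv_0_lt_compat; lra). nra. }
  rewrite <- Ew_scal. apply Ew_mono. intros w.
  destruct (HK w) as (u & [Hu _] & Hl).
  assert (Hpos : pos w = pos u).
  { specialize (Hu (false, 0%Z)). apply (f_equal snd) in Hu. rewrite !runL_pos in Hu. lia. }
  rewrite Hpos. apply Rmult_le_reg_l with (INR K); [lra|].
  rewrite <- Rmult_assoc, Rinv_r, Rmult_1_l, <- mult_INR by lra.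
  rewrite <- abs_IZR, INR_IZR_INZ. apply IZR_le. pose proof (pos_length u). lia.
Qed.

Lemma expected_norm_linear : exists c, 0 < c /\ forall n, E n <= c * INR n.
Proof.
  destruct norm_upper as (C & HC1 & HC). apply le_INR in HC1. simpl in HC1.
  exists (3 * INR C). split; [lra|]. intros n. rewrite expected_norm_Ew.
  rewrite <- (Ew_const n (3 * INR C * INR n) []). apply Ew_mono_len. intros u Hu.
  simpl length in Hu. specialize (HC u u (weq_refl p u)).
  assert (H : (nrm (mk p u) <= C * (3 * n))%nat) by nia.
  apply le_INR in H. rewrite !mult_INR in H.
  replace (INR 3) with 3 in H by (simpl; lra). lra.
Qed.

Lemma expected_norm_slow : exists c, 0 < c /\ forall m, slow_at p m ->
  exists n, (m <= n)%nat /\ E n <= c * Rpower (INR n) (1/2 + / INR (S m)).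
Proof.
  destruct norm_upper as (C & HC1 & HC). apply le_INR in HC1. simpl in HC1.
  exists (INR C). split; [lra|]. intros m [_ (n & L & Hn & HL & HE)].
  exists n. split; auto. rewrite expected_norm_Ew.
  apply Rle_trans with (INR C * Ew n L []); [|apply Rmult_le_compat_l; lra].
  rewrite <- Ew_scal. apply Ew_mono_len. intros w Hw. simpl length in Hw.
  destruct (HL w ltac:(lia)) as (w' & H1 & H2).
  apply HC, le_INR in H1. rewrite mult_INR in H1.
  apply Rle_trans with (1 := H1). apply Rmult_le_compat_l; lra.
Qed.

(** Where the norm is below [r = y / (4 K)], the function [F] is at least [exp (-y / 2)]; hence the
    norm is everywhere at least [r (1 - exp (y / 2) F)]. The mean of [F] is at most [exp (-y)], and
    [y >= 2] leaves a mean norm of at least [r / 2]. *)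
Lemma expected_norm_fast : exists c, 0 < c /\ forall m, fast_at p m ->
  exists n, (m <= n)%nat /\ c * Rpower (INR n) (1 - / INR (S m)) <= E n.
Proof.
  destruct norm_lower as (K & HK1 & HK). apply le_INR in HK1. simpl in HK1.
  exists (/ (8 * INR K)). split; [apply Rinv_0_lt_compat; lra|].
  intros m (n & F & Hn & _ & Hy & HF1 & HF2 & HE). exists n. split; auto.
  rewrite expected_norm_Ew. set (y := Rpower (INR n) (1 - / INR (S m))) in *.
  set (r := y / (4 * INR K)).
  assert (Hr : 0 <= r).
  { apply Rmult_le_pos; [lra|]. apply Rlt_le, Rinv_0_lt_compat; lra. }
  assert (G : Ew n (fun w => r * 1 + - (r * exp (y / 2)) * F w) [] <=
              Ew n (fun u => INR (nrm (mk p u))) []).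
  { apply Ew_mono. intros w. destruct (HK w) as (u & Hu & Hl).
    assert (HFw : exp (- (2 * INR K * INR (nrm (mk p w)))) <= F w).
    { rewrite <- (HF1 u w Hu). apply Rle_trans with (2 := HF2 u).
      rewrite pow_exp_ln by lra. apply exp_le.
      replace (1/4) with (/ 4) by lra. rewrite ln_Rinv by lra.
      pose proof ln_4_bounds. apply le_INR in Hl. rewrite mult_INR in Hl.
      pose proof (pos_INR (length u)). nra. }
    set (x := INR (nrm (mk p w))) in *. assert (Hx : 0 <= x) by apply pos_INR.
    pose proof (exp_pos (y / 2)) as P1. pose proof (exp_pos (- (2 * INR K * x))) as P2.
    destruct (Rle_dec r x) as [H|H].
    - assert (0 <= r * exp (y / 2) * F w).
      { apply Rmult_le_pos; [apply Rmult_le_pos|]; lra. }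
      lra.
    - assert (1 <= exp (y / 2) * F w).
      { apply Rle_trans with (exp (y / 2) * exp (- (2 * INR K * x))).
        - rewrite <- exp_plus. rewrite <- exp_0. apply exp_le.
          assert (2 * INR K * r = y / 2) by (unfold r; field; lra). nra.
        - apply Rmult_le_compat_l; lra. }
      assert (r * 1 <= r * (exp (y / 2) * F w)) by (apply Rmult_le_compat_l; lra).
      lra. }
  rewrite (Ew_lin n r _ (fun _ => 1)), Ew_const in G.
  assert (H1 : exp (y / 2) * Ew n F [] <= 1/2).
  { apply Rle_trans with (exp (y / 2) * exp (- y)).
    - apply Rmult_le_compat_l; auto. apply Rlt_le, exp_pos.
    - rewrite <- exp_plus. replace (y / 2 + - y) with (- (y / 2)) by lra.
      rewrite exp_Ropp. replace (1/2) with (/ 2) by lra.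
      apply Rinv_le_contravar; [lra|]. pose proof (exp_ineq1_le (y / 2)). lra. }
  assert (H2 : r * (exp (y / 2) * Ew n F []) <= r * (1/2)) by (apply Rmult_le_compat_l; lra).
  apply Rle_trans with (r / 2); [|lra].
  unfold r. right. field. lra.
Qed.

End Norm.

(** * Exponents *)

Lemma eventually_ln b : exists N, forall n, (N <= n)%nat -> b < ln (INR n).
Proof.
  destruct (exists_INR_ge (exp (b + 1))) as [N HN]. exists N. intros n Hn.
  apply le_INR in Hn. assert (exp b < INR n).
  { assert (exp b < exp (b + 1)) by (apply exp_increasing; lra). lra. }
  rewrite <- (ln_exp b) at 1. apply ln_increasing; auto. apply exp_pos.
Qed.

Lemma ratio_gt a e c l X : 0 < l -> c < e * l -> a * l - c <= X -> a - e < X / l.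
Proof.
  intros Hl Hc HX. apply Rmult_lt_reg_r with l; auto.
  unfold Rdiv. rewrite Rmult_assoc, Rinv_l by lra. lra.
Qed.

Lemma ratio_lt a e c l X : 0 < l -> c < e * l -> X <= a * l + c -> X / l < a + e.
Proof.
  intros Hl Hc HX. apply Rmult_lt_reg_r with l; auto.
  unfold Rdiv. rewrite Rmult_assoc, Rinv_l by lra. lra.
Qed.

Lemma eventually_small c e : 0 < e ->
  exists N, (2 <= N)%nat /\ forall n, (N <= n)%nat -> 0 < ln (INR n) /\ c < e * ln (INR n).
Proof.
  intros He. destruct (eventually_ln 0) as [N1 H1]. destruct (eventually_ln (c / e)) as [N2 H2].
  exists (N1 + N2 + 2)%nat. split; [lia|]. intros n Hn.
  specialize (H1 n ltac:(lia)). specialize (H2 n ltac:(lia)). split; auto.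
  replace c with (e * (c / e)) by (field; lra). apply Rmult_lt_compat_l; auto.
Qed.

Lemma exists_small_inv e N : 0 < e -> exists m, (N <= m)%nat /\ (1 <= m)%nat /\ / INR (S m) < e.
Proof.
  intros He. destruct (exists_INR_ge (/ e)) as [k Hk]. exists (k + N + 1)%nat.
  split; [lia|]. split; [lia|].
  assert (/ e < INR (S (k + N + 1))).
  { apply Rle_lt_trans with (1 := Hk). apply lt_INR. lia. }
  assert (0 < / e) by now apply Rinv_0_lt_compat.
  rewrite <- (Rinv_inv e). apply Rinv_lt_contravar; auto. apply Rmult_lt_0_compat; lra.
Qed.

Lemma ln_le x y : 0 < x -> x <= y -> ln x <= ln y.
Proof. intros Hx [H|<-]; [now apply Rlt_le, ln_increasing|lra]. Qed.

Lemma ln_Rpower x y : ln (Rpower x y) = y * ln x.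
Proof. apply ln_exp. Qed.

Lemma lnln_lower P y : 0 < P -> 0 < y -> P <= exp (- y) -> ln y <= ln (Rabs (ln P)).
Proof.
  intros HP Hy H. apply ln_le in H; auto. rewrite ln_exp in H.
  rewrite Rabs_left by lra. apply ln_le; lra.
Qed.

Lemma lnln_upper P y : 0 < P -> P < 1 -> exp (- y) <= P -> ln (Rabs (ln P)) <= ln y.
Proof.
  intros HP HP1 H. apply ln_le in H; [|apply exp_pos]. rewrite ln_exp in H.
  assert (ln P < 0) by (rewrite <- ln_1; now apply ln_increasing).
  rewrite Rabs_left by lra. apply ln_le; lra.
Qed.

Lemma retp_lt_1 p n : (1000 <= n)%nat -> retp p n < 1.
Proof.
  intros Hn. apply Rle_lt_trans with (1 := retp_upper p n Hn).
  assert (0 < Rpower (INR n) (1/3)) by apply exp_pos.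
  apply Rlt_le_trans with (exp 0); [apply exp_increasing; lra|rewrite exp_0; lra].
Qed.

Theorem theorem2 :
  exists (Delta : Grp) (mu : Delta -> R) (supp : list Delta),
    sym_fin_prob Delta mu supp /\
    liminf_on (fun n => 0 < return_prob Delta mu supp n)
      (fun n => ln (Rabs (ln (return_prob Delta mu supp n))) / ln (INR n)) (1/3) /\
    limsup_on (fun n => 0 < return_prob Delta mu supp n)
      (fun n => ln (Rabs (ln (return_prob Delta mu supp n))) / ln (INR n)) 1 /\
    (forall (T : list Delta) (nrm : Delta -> nat),
       is_word_norm Delta T nrm ->
       liminf_on (fun _ => True)
         (fun n => ln (expected_norm Delta mu supp nrm n) / ln (INR n)) (1/2) /\
       limsup_on (fun _ => True)
         (fun n => ln (expected_norm Delta mu supp nrm n) / ln (INR n)) 1).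
Proof.
  destruct good_parameters as [p Hp].
  exists (Delta p), (mu p), (supp p). split; [apply sym_fin_prob_mu|].
  split; [split|split; [split|]].
  - intros e He. destruct (eventually_small (ln 12) e He) as (N & _ & HN).
    exists (N + 1000)%nat. intros n Hn. rewrite return_prob_retp. intros HD.
    destruct (HN n ltac:(lia)) as [L1 L2].
    apply ratio_gt with (ln 12); auto.
    assert (HR : 0 < Rpower (INR n) (1/3)) by apply exp_pos.
    apply Rle_trans with (ln (Rpower (INR n) (1/3) / 12)).
    + unfold Rdiv in *. rewrite ln_mult, ln_Rpower, ln_Rinv by lra. lra.
    + apply lnln_lower; auto; [lra|]. apply retp_upper. lia.
  (* From time 1000 on the return probability is known to be below 1, so its logarithm is
     negative. *)
  - intros e He N. destruct (exists_small_inv e (N + 1000) He) as (m & Hm1 & Hm2 & Hm3).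
    destruct (proj1 (proj1 (Hp m Hm2))) as (n & Hn & HP).
    exists n. rewrite return_prob_retp.
    assert (HP0 : 0 < retp p n) by (pose proof (exp_pos (- Rpower (INR n) (1/3 + / INR (S m)))); lra).
    split; [lia|]. split; auto.
    assert (L : 0 < ln (INR n)).
    { rewrite <- ln_1. apply ln_increasing; [lra|]. apply (lt_INR 1). lia. }
    apply ratio_lt with (/ INR (S m) * ln (INR n)); [auto|apply Rmult_lt_compat_r; auto|].
    apply lnln_upper in HP; auto; [|apply retp_lt_1; lia].
    rewrite ln_Rpower in HP. lra.
  - intros e He. destruct (eventually_small (ln (ln 8)) e He) as (N & _ & HN).
    exists (N + 1000)%nat. intros n Hn. rewrite return_prob_retp. intros HD.
    destruct (HN n ltac:(lia)) as [L1 L2].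
    apply ratio_lt with (ln (ln 8)); auto.
    assert (L8 : 0 < ln 8) by (rewrite <- ln_1; apply ln_increasing; lra).
    assert (0 < INR n) by (apply lt_0_INR; lia).
    apply Rle_trans with (ln (INR n * ln 8)); [|rewrite ln_mult by auto; lra].
    apply lnln_upper; auto; [apply retp_lt_1; lia|].
    apply retp_lower in HD. rewrite pow_exp_ln in HD by lra.
    replace (1/8) with (/ 8) in HD by lra. rewrite ln_Rinv in HD by lra.
    replace (- (INR n * ln 8)) with (INR n * - ln 8) by ring. auto.
  - intros e He N. destruct (exists_small_inv e (N + 1000) He) as (m & Hm1 & Hm2 & Hm3).
    destruct (proj2 (Hp m Hm2)) as (n & F & Hn & Hev & Hy & HF1 & HF2 & HE).
    exists n. rewrite return_prob_retp. pose proof (retp_even_pos p n Hev) as HP0.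
    split; [lia|]. split; auto.
    assert (L : 0 < ln (INR n)).
    { rewrite <- ln_1. apply ln_increasing; [lra|]. apply (lt_INR 1). lia. }
    apply ratio_gt with (/ INR (S m) * ln (INR n)); [auto|apply Rmult_lt_compat_r; auto|].
    replace (1 * ln (INR n) - / INR (S m) * ln (INR n))
      with (ln (Rpower (INR n) (1 - / INR (S m)))) by (rewrite ln_Rpower; ring).
    apply lnln_lower; auto; [lra|].
    (* By its bound at the empty word [F] is at least 1 on words equal to the identity, so it
       dominates the indicator of a return. *)
    apply Rle_trans with (2 := HE). apply Ew_mono. intros w.
    destruct (classic (weq p w [])) as [H|H].
    + rewrite ind_true, (HF1 w [] H) by auto. apply (HF2 []).
    + rewrite ind_false by auto. apply Rle_trans with (2 := HF2 w). apply pow_le. lra.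
  - intros T nrm Hnrm. split; split.
    + destruct (expected_norm_diffusive p T nrm Hnrm) as (c & Hc & HE).
      intros e He. destruct (eventually_small (- ln c) e He) as (N & HN2 & HN).
      exists N. intros n Hn _. destruct (HN n Hn) as [L1 L2].
      apply ratio_gt with (- ln c); auto.
      specialize (HE n ltac:(lia)).
      assert (Hn0 : 0 < INR n) by (apply lt_0_INR; lia).
      apply ln_le in HE; [|apply Rmult_lt_0_compat; auto; now apply sqrt_lt_R0].
      rewrite ln_mult in HE by (auto; now apply sqrt_lt_R0).
      rewrite <- Rpower_sqrt, ln_Rpower in HE by auto. lra.
    + destruct (expected_norm_slow p T nrm Hnrm) as (c & Hc & HE).
      destruct (expected_norm_diffusive p T nrm Hnrm) as (c' & Hc' & HE').
      intros e He N. destruct (eventually_small (ln c) (e / 2) ltac:(lra)) as (N' & HN2 & HN').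
      destruct (exists_small_inv (e / 2) (N + N') ltac:(lra)) as (m & Hm1 & Hm2 & Hm3).
      destruct (HE m (proj1 (Hp m Hm2))) as (n & Hn & HEn).
      exists n. split; [lia|]. split; auto.
      destruct (HN' n ltac:(lia)) as [L1 L2].
      apply ratio_lt with (ln c + / INR (S m) * ln (INR n)); auto.
      { apply (Rmult_lt_compat_r (ln (INR n))) in Hm3; auto. lra. }
      apply ln_le in HEn.
      * rewrite ln_mult, ln_Rpower in HEn by (auto; apply exp_pos). lra.
      * apply Rlt_le_trans with (2 := HE' n ltac:(lia)).
        apply Rmult_lt_0_compat; auto. apply sqrt_lt_R0, lt_0_INR. lia.
    + destruct (expected_norm_linear p T nrm Hnrm) as (c & Hc & HE).
      destruct (expected_norm_diffusive p T nrm Hnrm) as (c' & Hc' & HE').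
      intros e He. destruct (eventually_small (ln c) e He) as (N & HN2 & HN).
      exists N. intros n Hn _. destruct (HN n Hn) as [L1 L2].
      apply ratio_lt with (ln c); auto.
      assert (Hn0 : 0 < INR n) by (apply lt_0_INR; lia).
      specialize (HE n). apply ln_le in HE.
      * rewrite ln_mult in HE by auto. lra.
      * apply Rlt_le_trans with (2 := HE' n ltac:(lia)).
        apply Rmult_lt_0_compat; auto. now apply sqrt_lt_R0.
    + destruct (expected_norm_fast p T nrm Hnrm) as (c & Hc & HE).
      intros e He N. destruct (eventually_small (- ln c) (e / 2) ltac:(lra)) as (N' & HN2 & HN').
      destruct (exists_small_inv (e / 2) (N + N') ltac:(lra)) as (m & Hm1 & Hm2 & Hm3).
      destruct (HE m (proj2 (Hp m Hm2))) as (n & Hn & HEn).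
      exists n. split; [lia|]. split; auto.
      destruct (HN' n ltac:(lia)) as [L1 L2].
      apply ratio_gt with (- ln c + / INR (S m) * ln (INR n)); auto.
      { apply (Rmult_lt_compat_r (ln (INR n))) in Hm3; auto. lra. }
      apply ln_le in HEn; [|apply Rmult_lt_0_compat; auto; apply exp_pos].
      rewrite ln_mult, ln_Rpower in HEn by (auto; apply exp_pos). lra.
Qed.
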